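(* Let $a,n\in \mathbb{Z}$ with $a\ge 1$ and $n\ge 2$. If $\gcd(a,n)=1$, then there exist infinitely many primes $p$ such that \[f_{n,a,p}(x)=x^n-ax^{n-1}-p\] is a monogenic strictly-Perron polynomial.
   Context: A monic polynomial $f(x)\in\mathbb{Z}[x]$ of degree $n$ is called monogenic if $f(x)$ is irreducible over $\mathbb{Q}$ and $\{1,\theta,\theta^2,\ldots,\theta^{n-1}\}$ is a basis for the ring of integers of $\mathbb{Q}(\theta)$, where $f(\theta)=0$. A Perron number is a real algebraic integer $\lambda>1$ such that $|\alpha|<\lambda$ for every Galois conjugate $\alpha\neq\lambda$ of $\lambda$; a Perron polynomial is the minimal polynomial of a Perron number. A Pisot number is a real algebraic integer $\lambda>1$ all of whose other conjugates have modulus less than $1$. A Salem number is a real algebraic integer $\lambda>1$ of even degree at least $4$ such that $\lambda^{-1}$ is a conjugate of $\lambda$ and all conjugates other than $\lambda,\lambda^{-1}$ have modulus exactly $1$. An anti-Pisot number is a real algebraic integer $\lambda>1$ such that exactly one conjugate of $\lambda$ has modulus less than $1$ and at least one conjugate other than $\lambda$ has modulus greater than $1$. A strictly-Perron polynomial is the minimal polynomial of a Perron number that is neither a Pisot number, an anti-Pisot number, nor a Salem number. *)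

(* Defs.v *)
From mathcomp Require Import all_boot all_order all_algebra all_field.

Set Implicit Arguments.
Unset Strict Implicit.
Unset Printing Implicit Defensive.

Import Order.TTheory GRing.Theory Num.Theory.
Local Open Scope ring_scope.

(* All algebraic numbers live in [algC], the algebraic closure of the
   rationals with its complex modulus. The order of [algC] is partial:
   [1 < x] holds only for real [x]. *)

Definition conjugate (lambda alpha : algC) : Prop :=
  root (minCpoly lambda) alpha.

Definition alg_degree (lambda : algC) : nat := (size (minCpoly lambda)).-1.

Definition real_algint_gt1 (lambda : algC) : Prop :=
  [/\ lambda \is Num.real, lambda \in Aint & 1 < lambda].

Definition perron (lambda : algC) : Prop :=
  real_algint_gt1 lambda /\
  forall alpha, conjugate lambda alpha -> alpha <> lambda -> `|alpha| < lambda.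

Definition pisot (lambda : algC) : Prop :=
  real_algint_gt1 lambda /\
  forall alpha, conjugate lambda alpha -> alpha <> lambda -> `|alpha| < 1.

Definition salem (lambda : algC) : Prop :=
  [/\ real_algint_gt1 lambda,
      ~~ odd (alg_degree lambda) /\ (4 <= alg_degree lambda)%N,
      conjugate lambda lambda^-1
    & forall alpha, conjugate lambda alpha ->
        alpha <> lambda -> alpha <> lambda^-1 -> `|alpha| = 1].

Definition anti_pisot (lambda : algC) : Prop :=
  [/\ real_algint_gt1 lambda,
      exists! alpha, conjugate lambda alpha /\ `|alpha| < 1
    & exists alpha,
        [/\ conjugate lambda alpha, alpha <> lambda & 1 < `|alpha|]].

Definition is_min_poly (f : {poly int}) (lambda : algC) : Prop :=
  map_poly intr f = minCpoly lambda.

Definition strictly_perron_poly (f : {poly int}) : Prop :=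
  exists lambda : algC,
    [/\ is_min_poly f lambda, perron lambda, ~ pisot lambda,
        ~ anti_pisot lambda & ~ salem lambda].

(* Membership in the subfield Q(theta) of [algC]. *)
Definition in_Qadjoin (theta x : algC) : Prop :=
  exists p q : {poly rat},
    (map_poly ratr q).[theta] != 0 /\
    x = (map_poly ratr p).[theta] / (map_poly ratr q).[theta].

Definition in_ring_of_integers (theta x : algC) : Prop :=
  in_Qadjoin theta x /\ x \in Aint.

(* [b] is a Z-basis of the additive subgroup [S] of [algC]. *)
Definition is_Zbasis (n : nat) (b : 'I_n -> algC) (S : algC -> Prop) : Prop :=
  [/\ forall i, S (b i),
      forall x, S x -> exists c : 'I_n -> int, x = \sum_(i < n) (c i)%:~R * b i
    & forall c : 'I_n -> int,
        \sum_(i < n) (c i)%:~R * b i = 0 -> forall i, c i = 0].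

Definition monogenic (f : {poly int}) : Prop :=
  [/\ f \is monic,
      irreducible_poly (map_poly intr f : {poly rat})
    & forall theta : algC, root (map_poly intr f) theta ->
        is_Zbasis (fun i : 'I_(size f).-1 => theta ^+ i)
                  (in_ring_of_integers theta)].

Definition f_poly (n : nat) (a : int) (p : nat) : {poly int} :=
  'X^n - a *: 'X^(n.-1) - (p%:Z)%:P.

(* Main.v *)
Require Import Defs.
From HB Require Import structures.
From mathcomp Require Import all_boot all_order all_algebra all_field.
From mathcomp Require Import zify ring lra.

Set Implicit Arguments.
Unset Strict Implicit.
Unset Printing Implicit Defensive.

Import Order.TTheory GRing.Theory Num.Theory.
Local Open Scope ring_scope.

(** Write f = X^n - a X^(n-1) - p and D = n^n p + a^n (n-1)^(n-1); up to sign the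
    discriminant of f is p^(n-2) D.  For p > a + 1 every complex root of f has
    modulus > 1.  As f(0) = -p is prime, f is then irreducible, and its positive
    root is a Perron number none of whose conjugates lies in the unit disc, so it
    is neither Pisot, anti-Pisot nor Salem.  By Dedekind's criterion f is
    monogenic as soon as D is squarefree: a multiple irreducible factor of f
    modulo a prime q divides f' = X^(n-2) (n X - a (n-1)), hence has an integer
    root c modulo q, with q^2 not dividing f(c).

    It remains to find infinitely many primes p with A p + B squarefree, where
    A = n^n and B = a^n (n-1)^(n-1) are coprime and A p + B is odd.  The primes
    p < N with q^2 | A p + B lie in one residue class modulo q^2, and Selberg's
    sieve bounds their number by about 2 N / (q (q-1) ln N).  Summed over odd
    q >= 3 this is 2 (1 - ln 2) N / ln N, whereas Chebyshev's lower bound gives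
    about ln 2 * N / ln N primes below N, and ln 2 > 2/3. *)

(** * Selberg's sieve *)

Lemma divn_minl m n d : (minn m n %/ d = minn (m %/ d) (n %/ d))%N.
Proof.
by case: (leqP m n) => [|/ltnW] mn; [rewrite (minn_idPl _) | rewrite (minn_idPr _)];
  rewrite ?leq_div2r.
Qed.

Lemma count_eqmodE N m r : (0 < m)%N ->
  (\sum_(0 <= n < N | n == r %[mod m]) 1 = (N + (m.-1 - r %% m)) %/ m)%N.
Proof.
move=> m0; have rm := ltn_pmod r m0.
elim: N => [|N IH]; first by rewrite big_geq // add0n divn_small //; lia.
rewrite big_mkcond big_nat_recr //= -big_mkcond IH addSn divnS // addnC.
congr (_ + _)%N.
suff -> : (N == r %[mod m]) = (m %| (N + (m.-1 - r %% m)).+1)%N by case: (_ %| _)%N.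
have -> : ((N + (m.-1 - r %% m)).+1 = N + (m - r %% m))%N by lia.
rewrite -(eqn_modDr (m - r %% m)%N) /dvdn -(modnDml r) addnC.
by rewrite (addnC (r %% m)%N) subnK ?modnn 1?addnC // ltnW.
Qed.

Section SquarefreeSums.
Variable R : realFieldType.
Implicit Types (w : nat -> R) (ps : seq nat).

(* The sum of the products of [w] over the prime factors of [e], for the squarefree
   [e <= x] with all prime factors in [ps]; iterated floor division of [x] by the
   chosen primes stays positive exactly when their product is at most [x]. *)
Fixpoint sqfsum w ps x : R :=
  if ps is p :: ps' then sqfsum w ps' x + w p * sqfsum w ps' (x %/ p)%N
  else (0 < x)%N%:R.

Lemma sqfsum0 w ps : sqfsum w ps 0 = 0.
Proof. by elim: ps => //= p ps IH; rewrite div0n IH mulr0 addr0. Qed.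

Lemma eq_sqfsum w w' ps x : {in ps, w =1 w'} -> sqfsum w ps x = sqfsum w' ps x.
Proof.
elim: ps x => //= p ps IH x /forall_cons[ww' {}/IH IH].
by rewrite ww' !IH.
Qed.

Lemma sqfsum_ge0 w ps x : {in ps, forall p, 0 <= w p} -> 0 <= sqfsum w ps x.
Proof.
elim: ps x => [|p ps IH] x /=; first by rewrite ler0n.
by case/forall_cons=> wp {}/IH IH; rewrite addr_ge0 ?mulr_ge0.
Qed.

Lemma le_sqfsum w ps x y : {in ps, forall p, 0 <= w p} -> (x <= y)%N ->
  sqfsum w ps x <= sqfsum w ps y.
Proof.
elim: ps x y => [|p ps IH] x y /=; first by rewrite ler_nat; lia.
by case/forall_cons=> wp w0 xy; rewrite lerD ?ler_wpM2l ?IH ?leq_div2r.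
Qed.

Lemma sqfsum_ge1 w ps x : {in ps, forall p, 0 <= w p} -> (0 < x)%N ->
  1 <= sqfsum w ps x.
Proof.
move=> + x0; elim: ps => [|p ps IH] /=; first by rewrite x0.
by case/forall_cons=> wp w0; rewrite -[1]addr0 lerD ?IH ?mulr_ge0 ?sqfsum_ge0.
Qed.

Lemma sqfsum_cat_le w qs ps x : {in qs ++ ps, forall p, 0 <= w p} ->
  sqfsum w (qs ++ ps) x <= (\prod_(q <- qs) (1 + w q)) * sqfsum w ps x.
Proof.
elim: qs => [|q qs IH] /=; first by rewrite big_nil mul1r.
case/forall_cons=> wq w0; rewrite big_cons -mulrA.
apply: le_trans (ler_wpM2l (addr_ge0 ler01 wq) (IH w0)).
by rewrite mulrDl mul1r lerD2l ler_wpM2l ?le_sqfsum ?leq_div.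
Qed.

Lemma count_eqmod_approx N m r : (0 < m)%N ->
  `|\sum_(0 <= n < N | n == r %[mod m]) 1 - N%:R / m%:R| <= 1 :> R.
Proof.
move=> m0; have m0R : 0 < m%:R :> R by rewrite ltr0n.
have -> : \sum_(0 <= n < N | n == r %[mod m]) 1
    = ((N + (m.-1 - r %% m)) %/ m)%:R :> R by rewrite -count_eqmodE // natr_sum.
set c := (m.-1 - _)%N; set k := (_ %/ _)%N.
have cm : (c < m)%N by rewrite /c; lia.
have lek : (k * m <= N + m)%N by have := leq_divM (N + c) m; rewrite -/k; lia.
have gek : (N <= k * m + m)%N by have := ltn_ceil (N + c) m0; rewrite -/k mulSn; lia.
move: lek gek; rewrite -(ler_nat R) -(ler_nat R N) !natrD natrM => lek gek.
have NE : N%:R / m%:R * m%:R = N%:R :> R by rewrite divfK ?gt_eqF.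
by rewrite ler_norml; apply/andP; split; rewrite -(ler_pM2r m0R); lra.
Qed.

Lemma ler_norm_lincomb (c c' u u' v : R) : 0 <= c -> 0 <= c' ->
  `|u| <= v -> `|u'| <= v -> `|c * u + c' * u'| <= (c + c') * v.
Proof.
move=> c0 c'0 uv u'v; rewrite (le_trans (ler_normD _ _)) // !normrM.
rewrite (ger0_norm c0) (ger0_norm c'0).
by rewrite mulrDl lerD // ler_wpM2l.
Qed.

Definition inv_pred p : R := (p%:R - 1)^-1.

(* In terms of Ramanujan's sum c_p(n), this is - c_p(n) / (p - 1). *)
Definition ramanujan_factor n p : R := if (p %| n)%N then -1 else inv_pred p.

Definition error_factor p : R := (p%:R + 1) / (p%:R - 1).

Lemma pred_natr_gt0 p : prime p -> 0 < p%:R - 1 :> R.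
Proof. by move=> pp; rewrite subr_gt0 ltr1n prime_gt1. Qed.

Lemma inv_pred_ge0 p : prime p -> 0 <= inv_pred p.
Proof. by move=> pp; rewrite invr_ge0 ltW ?pred_natr_gt0. Qed.

Lemma inv_pred_le1 p : prime p -> inv_pred p <= 1.
Proof.
move=> pp; rewrite invf_le1 ?pred_natr_gt0 // lerBrDr -[1 + 1]/(2%:R) ler_nat.
exact: prime_gt1.
Qed.

Lemma inv_predD1 p : prime p -> 1 + inv_pred p = p%:R * inv_pred p.
Proof. by move=> pp; rewrite /inv_pred; field; rewrite gt_eqF ?pred_natr_gt0. Qed.

Lemma error_factorE p : prime p -> error_factor p = inv_pred p + (1 + inv_pred p).
Proof.
move=> pp; rewrite /error_factor /inv_pred; field.
by rewrite gt_eqF ?pred_natr_gt0.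
Qed.

Lemma error_factor_ge1 p : prime p -> 1 <= error_factor p.
Proof. by move=> pp; rewrite error_factorE //; have := inv_pred_ge0 pp; lra. Qed.

Lemma error_factor_ge0 p : prime p -> 0 <= error_factor p.
Proof. by move=> /error_factor_ge1; exact: le_trans. Qed.

(* With w = 1/(p-1), the Ramanujan factor at p is w - (1 + w) [p | n], and its square is
   w^2 + (1 - w^2) [p | n]: this is how a second moment changes when p is added. *)
Definition moment_step p (E : nat -> nat -> nat -> R) d x y : R :=
  let w := inv_pred p in
  E d x y
  + (w * E d (x %/ p)%N y + (1 + w) * - E (d * p)%N (x %/ p)%N y)
  + (w * E d x (y %/ p)%N + (1 + w) * - E (d * p)%N x (y %/ p)%N)
  + (w ^+ 2 * E d (x %/ p)%N (y %/ p)%N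
     + (1 - w ^+ 2) * E (d * p)%N (x %/ p)%N (y %/ p)%N).

Section SieveMoment.
Variables N m r : nat.

Definition sieve_moment ps d x y : R :=
  \sum_(0 <= n < N | (n == r %[mod m]) && (d %| n)%N)
    sqfsum (ramanujan_factor n) ps x * sqfsum (ramanujan_factor n) ps y.

Definition moment_error ps d x y : R :=
  sieve_moment ps d x y - N%:R / (m * d)%:R * sqfsum inv_pred ps (minn x y).

Lemma sieve_momentE ps d x y : sieve_moment ps d x y =
  \sum_(0 <= n < N) ((n == r %[mod m]) && (d %| n)%N)%:R *
    (sqfsum (ramanujan_factor n) ps x * sqfsum (ramanujan_factor n) ps y).
Proof.
rewrite /sieve_moment big_mkcond; apply: eq_bigr => n _.
by case: ifP => _; rewrite ?mul1r ?mul0r.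
Qed.

Lemma sieve_moment_cons p ps d x y : coprime d p ->
  sieve_moment (p :: ps) d x y = moment_step p (sieve_moment ps) d x y.
Proof.
move=> dp; rewrite /moment_step !sieve_momentE !mulrN !mulr_sumr -!sumrN -!big_split /=.
apply: eq_bigr => n _; rewrite Gauss_dvd // /ramanujan_factor.
by case: (n == r %[mod m]) (d %| n)%N (p %| n)%N => [] [] [] /=; ring.
Qed.

(* Over a period the Ramanujan factor at p has mean 0 and mean square 1/(p-1), so the
   main term satisfies the same recursion. *)
Lemma moment_error_cons p ps d x y : (0 < m)%N -> (0 < d)%N -> prime p ->
  coprime d p ->
  moment_error (p :: ps) d x y = moment_step p (moment_error ps) d x y.
Proof.
move=> m0 d0 pp dp; rewrite /moment_step /moment_error sieve_moment_cons //=.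
rewrite /moment_step divn_minl !natrM /inv_pred; field.
by rewrite !pnatr_eq0 -!lt0n m0 d0 (prime_gt0 pp) gt_eqF ?pred_natr_gt0.
Qed.

Lemma moment_error_nil_le d x y : (0 < m)%N -> (0 < d)%N -> coprime m d ->
  `|moment_error [::] d x y| <= (0 < x)%N%:R * (0 < y)%N%:R.
Proof.
move=> m0 d0 md; set c := leRHS.
have -> : moment_error [::] d x y =
    c * (\sum_(0 <= n < N | n == chinese m d r 0 %[mod m * d]) 1
         - N%:R / (m * d)%:R).
  have minE : sqfsum inv_pred [::] (minn x y) = c by rewrite /= leq_min -mulnb natrM.
  rewrite /moment_error minE [_ / _ * c]mulrC mulrBr mulr_sumr; congr (_ - _).
  apply: eq_big => [n|n _]; last by rewrite mulr1.
  by rewrite chinese_remainder // chinese_modl // chinese_modr // mod0n.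
have c0 : 0 <= c by rewrite mulr_ge0 ?ler0n.
rewrite normrM (ger0_norm c0) ler_piMr // count_eqmod_approx //.
by rewrite muln_gt0 m0.
Qed.

Lemma moment_error_le ps d x y :
    (0 < m)%N -> (0 < d)%N -> coprime m d -> uniq ps ->
    {in ps, forall p, prime p /\ coprime (m * d) p} ->
  `|moment_error ps d x y| <= sqfsum error_factor ps x * sqfsum error_factor ps y.
Proof.
move=> m0; elim: ps d x y => [|p ps IH] d x y d0 md.
  by move=> _ _; exact: moment_error_nil_le.
rewrite [uniq _]/= => /andP[pps ups] /forall_cons[[pp mdp] cops].
move: (mdp); rewrite coprimeMl => /andP[mp dp].
have Ed u v : `|moment_error ps d u v|
    <= sqfsum error_factor ps u * sqfsum error_factor ps v by exact: IH.
have Edp u v : `|moment_error ps (d * p) u v|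
    <= sqfsum error_factor ps u * sqfsum error_factor ps v.
  apply: IH => //; [by rewrite muln_gt0 d0 prime_gt0 | by rewrite coprimeMr md |].
  move=> q qps; have [qp mdq] := cops q qps.
  rewrite mulnA coprimeMl mdq /= prime_coprime // dvdn_prime2 //.
  by split=> //; apply: contraNneq pps => ->.
have w0 := inv_pred_ge0 pp; have w1 := inv_pred_le1 pp.
have e0 := error_factor_ge0 pp.
have U0 z : 0 <= sqfsum error_factor ps z.
  by apply: sqfsum_ge0 => q /cops[/error_factor_ge0].
rewrite moment_error_cons //= /moment_step.
set w := inv_pred p in w0 w1 *; set U := sqfsum error_factor ps in Ed Edp U0 *.
have -> : (U x + error_factor p * U (x %/ p)%N) * (U y + error_factor p * U (y %/ p)%N)
  = U x * U y + error_factor p * (U (x %/ p)%N * U y)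
  + error_factor p * (U x * U (y %/ p)%N)
  + error_factor p ^+ 2 * (U (x %/ p)%N * U (y %/ p)%N) by ring.
have w1p : 0 <= 1 + w by lra.
do 3?[apply: le_trans (ler_normD _ _) _; apply: lerD]; first exact: Ed.
- by rewrite error_factorE // ler_norm_lincomb ?normrN.
- by rewrite error_factorE // ler_norm_lincomb ?normrN.
apply: (@le_trans _ _ ((w ^+ 2 + (1 - w ^+ 2)) * (U (x %/ p)%N * U (y %/ p)%N))).
  by rewrite ler_norm_lincomb ?sqr_ge0 ?subr_ge0 ?exprn_ile1.
rewrite subrKC ler_wpM2r ?mulr_ge0 // exprn_ege1 //.
exact: error_factor_ge1.
Qed.

End SieveMoment.

(* If no prime of [ps] divides n, all the Ramanujan factors at n are 1/(p-1), so
   n contributes the square of [sqfsum inv_pred ps D] to the second moment. *)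
Lemma selberg_sieve N m r D ps :
    (0 < m)%N -> (0 < D)%N -> uniq ps ->
    {in ps, forall p, prime p /\ coprime m p} ->
  \sum_(0 <= n < N | (n == r %[mod m]) && all (fun p => ~~ (p %| n)%N) ps) 1
    <= N%:R / (m%:R * sqfsum inv_pred ps D) + sqfsum error_factor ps D ^+ 2.
Proof.
move=> m0 D0 ups cops; set C := \sum_(_ <= _ < _ | _) _.
have G1 : 1 <= sqfsum inv_pred ps D.
  by apply: sqfsum_ge1 => // p /cops[/inv_pred_ge0].
have CG : C * sqfsum inv_pred ps D ^+ 2 <= sieve_moment N m r ps 1 D D.
  rewrite mulr_suml big_mkcond [leRHS]big_mkcond /=; apply: ler_sum => n _.
  rewrite dvd1n andbT; case: (n == r %[mod m]) => //=.
  case: allP => [ndvd|_]; last by rewrite -expr2 sqr_ge0.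
  rewrite mul1r expr2 (@eq_sqfsum (ramanujan_factor n) inv_pred) // => p /ndvd.
  by rewrite /ramanujan_factor => /negPf ->.
have := @moment_error_le N m r ps 1 D D m0 isT (coprimen1 m) ups.
rewrite /moment_error muln1 minnn -expr2 => /(_ cops)/(le_trans (ler_norm _)).
set G := sqfsum inv_pred ps D in G1 CG *; set U := _ ^+ 2 => moment_le.
have G0 : 0 < G by apply: lt_le_trans G1.
have m0R : 0 < m%:R :> R by rewrite ltr0n.
rewrite -(ler_pM2r (exprn_gt0 2 G0)) mulrDl.
have -> : N%:R / (m%:R * G) * G ^+ 2 = N%:R / m%:R * G by field; rewrite !gt_eqF.
have : U <= U * G ^+ 2 by rewrite ler_peMr ?sqr_ge0 ?exprn_ege1.
by lra.
Qed.

End SquarefreeSums.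

Lemma size_lt_sorted_primes p ps :
  sorted gtn (p :: ps) -> {in p :: ps, forall q, prime q} -> ((size ps).+1 < p)%N.
Proof.
elim: ps p => [|q ps IH] p /=; first by move=> _ /forall_cons[/prime_gt1].
by move=> /andP[qp sps] /forall_cons[_ pr]; apply: leq_ltn_trans qp; exact: IH.
Qed.

Section SmoothSums.
Variable R : realFieldType.
Implicit Types (f : nat -> R) (ps qs : seq nat).

Definition smooth_sum f ps x : R :=
  \sum_(1 <= t < x.+1 | all (mem ps) (primes t)) f t.

Lemma smooth_sum0 f ps : smooth_sum f ps 0 = 0.
Proof. by rewrite /smooth_sum big_geq. Qed.

Lemma smooth_sumS f ps x : smooth_sum f ps x.+1 =
  smooth_sum f ps x + (if all (mem ps) (primes x.+1) then f x.+1 else 0).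
Proof. by rewrite /smooth_sum big_mkcond big_nat_recr //= -big_mkcond. Qed.

Lemma smooth_sum_nil f x : smooth_sum f [::] x = (0 < x)%N%:R * f 1%N.
Proof.
elim: x => [|x IH]; first by rewrite smooth_sum0 mul0r.
have -> : smooth_sum f [::] x.+1 = smooth_sum f [::] x + (x == 0)%N%:R * f 1%N.
  rewrite smooth_sumS; have -> : all (mem [::]) (primes x.+1) = (x < 1)%N.
    by rewrite -[RHS](primes_eq0 x.+1); case: primes.
  by case: x {IH} => [|x]; rewrite ?mul1r ?mul0r.
by rewrite IH -mulrDl; case: x {IH} => [|x]; rewrite ?add0r ?addr0.
Qed.

Lemma le_smooth_sum f ps x y : (forall t, 0 <= f t) -> (x <= y)%N ->
  smooth_sum f ps x <= smooth_sum f ps y.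
Proof.
move=> f0 /subnK <-; elim: (y - x)%N => // k IH; rewrite addSn smooth_sumS.
by rewrite (le_trans IH) // lerDl; case: ifP.
Qed.

Lemma smooth_sum_sub f ps qs x : (forall t, 0 <= f t) -> {subset ps <= qs} ->
  smooth_sum f ps x <= smooth_sum f qs x.
Proof.
move=> f0 pq; rewrite /smooth_sum big_mkcond [leRHS]big_mkcond; apply: ler_sum => t _.
case: ifP => [smooth_t|_]; last by case: ifP.
by rewrite (sub_all _ smooth_t).
Qed.

Lemma smooth_sum_full f ps x : (forall p, prime p -> (p <= x)%N -> p \in ps) ->
  smooth_sum f ps x = \sum_(1 <= t < x.+1) f t.
Proof.
move=> full; rewrite /smooth_sum big_nat_cond [RHS]big_nat; apply: eq_bigl => t.
case: (boolP (1 <= t < x.+1)%N) => //= /andP[_ tx].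
apply/allP => p; rewrite mem_primes => /and3P[pp t0 /(dvdn_leq t0) pt].
by apply: full => //; exact: leq_trans pt tx.
Qed.

Lemma smooth_sum_cons f p ps x : prime p -> p \notin ps ->
    (forall t, f (p * t)%N = f p * f t) ->
  smooth_sum f (p :: ps) x
    = smooth_sum f ps x + f p * smooth_sum f (p :: ps) (x %/ p).
Proof.
move=> pp pps fM; elim: x => [|x IH].
  by rewrite div0n !smooth_sum0 mulr0 addr0.
rewrite !smooth_sumS divnS ?prime_gt0 // IH; case: (boolP (p %| x.+1)%N) => px.
  have xE : x.+1 = (p * (x %/ p).+1)%N.
    by have := divnS x (prime_gt0 pp); rewrite px add1n => <-; rewrite mulnC divnK.
  have -> : all (mem ps) (primes x.+1) = false.
    by apply/allPn; exists p => //; rewrite mem_primes pp px.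
  have -> : all (mem (p :: ps)) (primes x.+1) =
      all (mem (p :: ps)) (primes (x %/ p).+1).
    have memE q : (q \in primes x.+1) = (q == p) || (q \in primes (x %/ p).+1).
      by rewrite xE primesM ?(prime_gt0 pp) // (primes_prime pp) inE.
    apply/allP/allP => smooth q; first by move=> qx; rewrite smooth ?memE ?qx ?orbT.
    by rewrite memE => /orP[/eqP->|/smooth //]; rewrite /= mem_head.
  by rewrite add1n smooth_sumS; case: ifP => _; rewrite ?[f x.+1](congr1 f xE) ?fM; ring.
have -> : all (mem (p :: ps)) (primes x.+1) = all (mem ps) (primes x.+1).
  apply: eq_in_all => q; rewrite mem_primes => /and3P[_ _ qx] /=.
  by rewrite inE (negPf (contraNneq _ px)) // => <-.
by rewrite add0n; ring.
Qed.

Section CompletelyMultiplicative.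
Variable f : nat -> R.
Hypotheses (f_ge0 : forall t, 0 <= f t) (f1 : f 1%N = 1).
Hypothesis fM : forall s t, f (s * t)%N = f s * f t.

Lemma sqfsum_le_smooth_sum ps x : uniq ps -> {in ps, forall p, prime p} ->
  sqfsum f ps x <= smooth_sum f ps x.
Proof.
elim: ps x => [|p ps IH] x /=; first by rewrite smooth_sum_nil f1 mulr1.
case/andP=> pps ups /forall_cons[pp pr].
rewrite smooth_sum_cons // lerD ?IH // ler_wpM2l // (le_trans (IH _ ups pr)) //.
by apply: smooth_sum_sub => // q qps; rewrite inE qps orbT.
Qed.

(* The geometric series over the powers of each prime gives the weight
   f(p) / (1 - f(p)). *)
Lemma smooth_sum_le_sqfsum ps x : uniq ps ->
    {in ps, forall p, prime p /\ f p < 1} ->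
  smooth_sum f ps x <= sqfsum (fun p => f p / (1 - f p)) ps x.
Proof.
elim: ps x => [|p ps IH] x /=; first by rewrite smooth_sum_nil f1 mulr1.
case/andP=> pps ups /forall_cons[[pp fp1] pr]; set w := f p / (1 - f p).
have {}IH y : smooth_sum f ps y <= sqfsum (fun p => f p / (1 - f p)) ps y by exact: IH.
have w0 : 0 <= w by rewrite divr_ge0 // subr_ge0 ltW.
have wE : w = f p * (1 + w) by rewrite /w; field; rewrite gt_eqF // subr_gt0.
suff : smooth_sum f (p :: ps) x <= smooth_sum f ps x + w * smooth_sum f ps (x %/ p).
  by move=> /le_trans; apply; rewrite lerD ?ler_wpM2l.
elim/ltn_ind: x => x IHx; case: (posnP x) => [->|x0].
  by rewrite div0n !smooth_sum0 mulr0 addr0.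
rewrite smooth_sum_cons // lerD2l wE -mulrA ler_wpM2l // mulrDl mul1r.
apply: le_trans (IHx (x %/ p)%N (ltn_Pdiv (prime_gt1 pp) x0)) _.
by rewrite lerD2l ler_wpM2l // le_smooth_sum ?leq_div.
Qed.

End CompletelyMultiplicative.

Definition harmonic x : R := \sum_(0 <= t < x) t.+1%:R^-1.

Lemma harmonic_ge0 x : 0 <= harmonic x.
Proof. by apply: sumr_ge0 => t _; rewrite invr_ge0. Qed.

Lemma harmonic_gt0 x : (0 < x)%N -> 0 < harmonic x.
Proof.
case: x => // x _; rewrite /harmonic big_nat_recl // invr1.
by rewrite (lt_le_trans ltr01) // lerDl sumr_ge0 // => t _; rewrite invr_ge0.
Qed.

Lemma harmonic_le_sqfsum qs ps x : uniq (qs ++ ps) ->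
    {in qs ++ ps, forall p, prime p} ->
    (forall p, prime p -> (p <= x)%N -> p \in qs ++ ps) ->
  harmonic x <= (\prod_(q <- qs) (1 + inv_pred R q)) * sqfsum (inv_pred R) ps x.
Proof.
move=> uqps pr full; pose f (t : nat) : R := t%:R^-1.
have f0 t : 0 <= f t by rewrite invr_ge0.
have fM s t : f (s * t)%N = f s * f t by rewrite /f natrM invfM.
have -> : harmonic x = smooth_sum f (qs ++ ps) x.
  by rewrite smooth_sum_full // big_add1.
have f_lt1 : {in qs ++ ps, forall p, prime p /\ f p < 1}.
  move=> p /pr pp; rewrite invf_lt1 ?ltr0n ?prime_gt0 //.
  by rewrite ltr1n prime_gt1.
apply: (le_trans (smooth_sum_le_sqfsum f0 (invr1 _) fM x uqps f_lt1)).
rewrite (@eq_sqfsum _ _ (inv_pred R)) => [|p /pr pp].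
  by apply: sqfsum_cat_le => p /pr; exact: inv_pred_ge0.
rewrite /f /inv_pred; field; rewrite gt_eqF ?pred_natr_gt0 //=.
by rewrite pnatr_eq0 -lt0n prime_gt0.
Qed.

Lemma prod_inv_pred_primes m : (0 < m)%N ->
  (totient m)%:R * \prod_(p <- primes m) (1 + inv_pred R p) = m%:R.
Proof.
move=> m0; rewrite totientE // {4}(prod_prime_decomp m0) prime_decompE big_map /=.
rewrite !natr_prod -big_split /=; apply: eq_big_seq => p pm.
have pp : prime p by move: pm; rewrite mem_primes => /andP[].
rewrite inv_predD1 // -(prednK (n := logn p m)) ?logn_gt0 // expnS !natrM /inv_pred.
rewrite -subn1 natrB ?prime_gt0 //; field.
by rewrite gt_eqF ?pred_natr_gt0.
Qed.

Lemma error_factor_bin2 p k : (k.+1 < p)%N ->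
  error_factor R p * 'C(k.+2, 2)%:R <= 'C(k.+3, 2)%:R.
Proof.
move=> kp; have kpR : k.+2%:R <= p%:R :> R by rewrite ler_nat.
have k0 := ler0n R k; have b0 := ler0n R 'C(k.+3, 2).
have /(congr1 (GRing.natmul (1 : R))) := mul_bin_down k.+3 2.
rewrite (_ : k.+3 - 2 = k.+1)%N ?subSS ?subn0 // !natrM /= => binE.
have := binE; rewrite -!natr1 in kpR *; set b := 'C(k.+2, 2)%:R in binE *.
set b' := 'C(_, 2)%:R in b0 *.
rewrite /error_factor mulrAC ler_pdivrMr; last by lra.
by move=> {}binE; nra.
Qed.

(* The i-th smallest prime is at least i + 1, hence a product of [k] error factors
   is at most the telescoping product of the (i + 3) / (i + 1) for [i < k]; and a
   squarefree number below [2 ^ w] has at most [w] prime factors. *)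
Lemma sqfsum_error_factor_le ps x w : sorted gtn ps -> {in ps, forall p, prime p} ->
    (x < 2 ^ w)%N ->
  sqfsum (error_factor R) ps x
    <= 'C((minn w (size ps)).+2, 2)%:R * sqfsum (fun=> 1 : R) ps x.
Proof.
elim: ps x w => [|p ps IH] x w; first by rewrite minn0 binn mul1r.
case: w => [|w] sps pr xw.
  by rewrite (_ : x = 0)%N ?sqfsum0 ?mulr0 //; case: x xw.
have /forall_cons[pp pr'] := pr; have sps' := path_sorted sps.
have le_p := size_lt_sorted_primes sps pr.
have S0 y : 0 <= sqfsum (fun=> 1 : R) ps y by apply: sqfsum_ge0.
rewrite /= minnSS mul1r mulrDr lerD //.
  rewrite (le_trans (IH x w.+1 sps' pr' xw)) // ler_wpM2r // ler_nat leq_bin2l //.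
  by lia.
have xpw : (x %/ p < 2 ^ w)%N.
  rewrite ltn_divLR ?prime_gt0 // (leq_trans xw) // expnS mulnC leq_mul2l.
  by rewrite prime_gt1 // orbT.
apply: (le_trans (ler_wpM2l (error_factor_ge0 R pp) (IH _ _ sps' pr' xpw))).
by rewrite mulrA ler_wpM2r // error_factor_bin2 //; lia.
Qed.

Lemma sqfsum_error_factor_le_bin ps x w : sorted gtn ps ->
    {in ps, forall p, prime p} -> (x < 2 ^ w)%N ->
  sqfsum (error_factor R) ps x <= ('C(w.+2, 2) * x)%:R.
Proof.
move=> sps pr xw; rewrite (le_trans (sqfsum_error_factor_le sps pr xw)) // natrM.
have ups : uniq ps := sorted_uniq (rev_trans ltn_trans) ltnn sps.
have S_le : sqfsum (fun=> 1 : R) ps x <= x%:R.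
  apply: (le_trans (sqfsum_le_smooth_sum _ _ _ x ups pr)) => // [s t|].
    by rewrite mulr1.
  apply: (@le_trans _ _ (\sum_(1 <= t < x.+1) 1)).
    by rewrite /smooth_sum big_mkcond ler_sum // => t _; case: ifP.
  by rewrite sumr_const_nat subn1.
apply: ler_pM => //; first by apply: sqfsum_ge0.
by rewrite ler_nat leq_bin2l //; lia.
Qed.

Theorem brun_titchmarsh N m r D w : (0 < m)%N -> (0 < D < 2 ^ w)%N ->
  \sum_(0 <= n < N | [&& n == r %[mod m], prime n & (D < n)%N]) 1
    <= N%:R / ((totient m)%:R * harmonic D) + ('C(w.+2, 2) * D)%:R ^+ 2.
Proof.
move=> m0 /andP[D0 Dw].
pose ps := [seq p <- rev (iota 0 D.+1) | prime p && ~~ (p %| m)%N].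
have mem_ps p : (p \in ps) = [&& prime p, ~~ (p %| m)%N & (p <= D)%N].
  by rewrite mem_filter mem_rev mem_iota /= add0n ltnS andbA.
have pr : {in ps, forall p, prime p} by move=> p; rewrite mem_ps => /and3P[].
have sps : sorted gtn ps.
  by rewrite (sorted_filter (rev_trans ltn_trans)) // rev_sorted iota_ltn_sorted.
have ups : uniq ps by rewrite filter_uniq // rev_uniq iota_uniq.
have cops : {in ps, forall p, prime p /\ coprime m p}.
  by move=> p; rewrite mem_ps => /and3P[pp pm _]; rewrite coprime_sym prime_coprime.
have sieve := selberg_sieve R N r m0 D0 ups cops.
set G := sqfsum (inv_pred R) ps D in sieve.
have G1 : 1 <= G by apply: sqfsum_ge1 => // p /pr; exact: inv_pred_ge0.
have totient_harmonic : (totient m)%:R * harmonic D <= m%:R * G.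
  rewrite -[X in _ <= X * _](prod_inv_pred_primes m0) -mulrA ler_wpM2l //.
  apply: harmonic_le_sqfsum => [|p|p pp pD].
  - rewrite cat_uniq primes_uniq ups andbT /=; apply/hasPn => p.
    by rewrite mem_ps mem_primes => /and3P[_ /negPf-> _]; rewrite !andbF.
  - by rewrite mem_cat mem_primes => /orP[/andP[]|/pr].
  - by rewrite mem_cat mem_primes mem_ps pp m0 pD andbT /=; case: (p %| m)%N.
apply: le_trans (le_trans _ sieve) _; last apply: lerD.
- rewrite big_mkcond [leRHS]big_mkcond /=; apply: ler_sum => n _.
  case: (n == r %[mod m]) => //=; case: ifP => [/andP[np Dn]|_]; last by case: ifP.
  rewrite (introT allP) // => p; rewrite mem_ps => /and3P[pp _ pD].
  by rewrite dvdn_prime2 // ltn_eqF // (leq_ltn_trans pD).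
- rewrite ler_wpM2l // lef_pV2 ?posrE // mulr_gt0 ?ltr0n ?totient_gt0 ?harmonic_gt0 //.
  exact: lt_le_trans G1.
- rewrite ler_sqr ?nnegrE ?ler0n //; first exact: sqfsum_error_factor_le_bin.
  by apply: sqfsum_ge0 => p /pr; exact: error_factor_ge0.
Qed.

End SmoothSums.

(** * Chebyshev's lower bound *)

Section CentralBinomial.
Local Open Scope nat_scope.

Definition prime_count N := \sum_(0 <= p < N | prime p) 1.

Lemma sum_ltn_minn N t : \sum_(0 <= n < N) (n < t) = minn N t.
Proof.
elim: N => [|N IH]; first by rewrite big_geq // min0n.
by rewrite big_nat_recr //= IH; lia.
Qed.

Lemma divn_double_le n d : 0 < d -> n.*2 %/ d <= (n %/ d).*2 + (d <= n.*2).
Proof.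
move=> d0; case: (leqP d n.*2) => dn; last by rewrite divn_small.
rewrite addn1 -ltnS ltn_divLR // -doubleS -doubleMl ltn_double.
exact: ltn_ceil.
Qed.

Lemma logn_fact_double_le p n : prime p ->
  logn p (n.*2)`! <= (logn p n`!).*2 + trunc_log p n.*2.
Proof.
move=> pp; have p1 := prime_gt1 pp.
have -> : (logn p n`!).*2 = \sum_(1 <= k < n.*2.+1) (n %/ p ^ k).*2.
  rewrite logn_fact // -muln2 big_distrl /= [RHS](@big_cat_nat _ _ _ n.+1) //=;
    last by rewrite ltnS -addnn leq_addr.
  rewrite [X in _ = _ + X]big_nat [X in _ = _ + X]big1 => [|k /andP[nk _]].
    by rewrite addn0; apply: eq_bigr => k _; rewrite muln2.
  by rewrite divn_small // (ltn_trans nk) // ltn_expl.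
rewrite logn_fact //.
apply: (@leq_trans
  (\sum_(1 <= k < n.*2.+1) ((n %/ p ^ k).*2 + (k.-1 < trunc_log p n.*2)))).
  rewrite big_nat [leqRHS]big_nat; apply: leq_sum => k /andP[k0 kn].
  rewrite (leq_trans (divn_double_le n _)) ?expn_gt0 ?prime_gt0 // leq_add2l.
  by rewrite prednK //; case: (leqP (p ^ k) n.*2) => // /(trunc_log_max p1) ->.
by rewrite big_split leq_add2l big_add1 /= sum_ltn_minn geq_minr.
Qed.

Lemma expn_logn_central_bin_le p n : prime p -> 0 < n ->
  p ^ logn p 'C(n.*2, n) <= n.*2.
Proof.
move=> pp n0; have n20 : 0 < n.*2 by rewrite double_gt0.
have nn : n <= n.*2 by rewrite -addnn leq_addr.
apply: leq_trans (trunc_logP (prime_gt1 pp) n20); rewrite leq_exp2l ?prime_gt1 //.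
have := logn_fact_double_le n pp; rewrite -(bin_fact nn).
have -> : n.*2 - n = n by rewrite -addnn addnK.
rewrite !lognM ?muln_gt0 ?fact_gt0 ?bin_gt0 // addnn addnC.
by rewrite leq_add2l.
Qed.

Lemma central_bin_ge n : 0 < n -> 4 ^ n <= n.*2 * 'C(n.*2, n).
Proof.
case: n => // n _; elim: n => [//|n IH].
set m := n.+1 in IH *.
have diag := mul_bin_diag m.*2.+2 m.
have down := mul_bin_down m.*2.+1 m.
rewrite /= (_ : m.*2.+1 - m = m.+1) in diag down; last by lia.
have -> : m.+1.*2 * 'C(m.+1.*2, m.+1) = 4 * (m.*2.+1 * 'C(m.*2, m)).
  by move: diag; rewrite down -doubleS; lia.
by rewrite expnS leq_mul2l (leq_trans IH) ?orbT // leq_mul2r leqnSn orbT.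
Qed.

Lemma central_bin_le_prime_count n : 1 < n ->
  'C(n.*2, n) <= n.*2 ^ prime_count n.*2.
Proof.
move=> n1; have n0 := ltnW n1.
have c0 : 0 < 'C(n.*2, n) by rewrite bin_gt0 -addnn leq_addr.
set s := primes 'C(n.*2, n).
have size_s : size s <= prime_count n.*2.
  rewrite /prime_count sum1_count -size_filter uniq_leq_size ?primes_uniq // => p.
  rewrite mem_primes mem_filter mem_index_iota => /and3P[pp _ pc]; rewrite pp /=.
  have : p <= n.*2.
    apply: leq_trans (expn_logn_central_bin_le pp n0).
    by rewrite -{1}(expn1 p) leq_exp2l ?prime_gt1 // logn_gt0 mem_primes pp c0.
  rewrite leq_eqVlt => /orP[/eqP pE|//].
  by case: (even_prime pp); [lia | rewrite pE odd_double].
rewrite {1}(prod_prime_decomp c0) prime_decompE big_map /= -/s.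
apply: (@leq_trans (\prod_(p <- s) n.*2)).
  rewrite big_seq [leqRHS]big_seq; apply: leq_prod => p.
  by rewrite mem_primes => /and3P[pp _ _]; exact: expn_logn_central_bin_le.
by rewrite big_const_seq count_predT iter_muln_1 leq_pexp2l ?double_gt0.
Qed.

Lemma prime_count_pow2_ge k : 1 < k -> 2 ^ k <= k * (prime_count (2 ^ k)).+1.
Proof.
case: k => // k k0; set n := 2 ^ k.
have n1 : 1 < n by rewrite -[1]/(2 ^ 0) ltn_exp2l.
have n2 : 2 ^ k.+1 = n.*2 by rewrite expnS mul2n.
rewrite -(@leq_exp2l 2) // n2 expnM -mul2n expnM mul2n n2.
apply: leq_trans (central_bin_ge (ltnW n1)) _.
by rewrite expnS leq_mul2l central_bin_le_prime_count ?orbT.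
Qed.

Lemma exists_pow2_ge K e l0 : exists2 l, l0 < l & K * l ^ e <= 2 ^ l.
Proof.
set t := (e.+1 ^ e * K + l0).+1.
exists (e.+1 * t); first by rewrite /t mulSn; lia.
rewrite [X in 2 ^ X]mulnC expnM; apply: (@leq_trans (t ^ e.+1)).
  by rewrite expnS expnMn mulnA leq_mul2r mulnC /t; apply/orP; right; lia.
by rewrite leq_exp2r // ltnW // ltn_expl.
Qed.
End CentralBinomial.

(** * Squarefree values at primes *)

Section HarmonicBounds.
Variable R : realFieldType.

Lemma harmonicS x : harmonic R x.+1 = harmonic R x + x.+1%:R^-1.
Proof. by rewrite /harmonic big_nat_recr. Qed.

(* Catalan's identity: H(2x) - H(x) is a partial sum of the alternating harmonic
   series. *)
Lemma harmonic_double_diff x :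
  harmonic R x.*2 - harmonic R x = \sum_(0 <= t < x) ((t.*2.+1 * t.*2.+2)%:R)^-1.
Proof.
elim: x => [|x IH]; first by rewrite /harmonic !big_geq ?subrr.
rewrite big_nat_recr //= -IH doubleS !harmonicS natrM -muln2 -!natr1 !natrM.
by have x0 := ler0n R x; field; apply/and3P; split; rewrite gt_eqF //; lra.
Qed.

Lemma harmonic_double_diff_ge x : (16 <= x)%N ->
  27 / 40 <= harmonic R x.*2 - harmonic R x.
Proof.
move=> x16; rewrite harmonic_double_diff (@big_cat_nat _ _ _ 16) //=.
apply: (@le_trans _ _ (\sum_(0 <= t < 16) ((t.*2.+1 * t.*2.+2)%:R)^-1)).
  by rewrite unlock /double /=; lra.
by rewrite lerDl sumr_ge0 // => t _; rewrite invr_ge0.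
Qed.

Lemma harmonic_pow2_ge j : (4 <= j)%N -> 27 / 40 * j%:R <= harmonic R (2 ^ j).
Proof.
move=> /subnK <-; elim: (j - 4)%N => [|k IH].
  by rewrite /harmonic unlock /=; lra.
have pow_ge : (16 <= 2 ^ (k + 4))%N by rewrite -[16%N]/(2 ^ 4)%N leq_exp2l ?leq_addl.
have := harmonic_double_diff_ge pow_ge.
by rewrite addSn expnS mul2n -natr1; lra.
Qed.

Lemma sum_inv_odd_mul_predE n :
  \sum_(0 <= i < n) (i.*2.+3%:R * (i.*2.+3%:R - 1))^-1
    = 1 - (harmonic R n.*2.+1 - harmonic R n).
Proof.
elim: n => [|n IH]; first by rewrite harmonicS /harmonic !big_geq // invr1; ring.
rewrite big_nat_recr //= IH doubleS !harmonicS -muln2 -!natr1 natrM.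
by have n0 := ler0n R n; field; apply/and3P; split; rewrite gt_eqF //; lra.
Qed.

Lemma sum_inv_odd_mul_pred_le n :
  \sum_(0 <= i < n) (i.*2.+3%:R * (i.*2.+3%:R - 1))^-1 <= 13 / 40 :> R.
Proof.
apply: (@le_trans _ _ (\sum_(0 <= i < n + 16) (i.*2.+3%:R * (i.*2.+3%:R - 1))^-1)).
  rewrite [leRHS](@big_cat_nat _ _ _ n) ?leq_addr //= lerDl sumr_ge0 // => i _.
  by rewrite invr_ge0 mulr_ge0 // subr_ge0 ler1n.
rewrite sum_inv_odd_mul_predE harmonicS.
have := harmonic_double_diff_ge (leq_addl n 16).
have : 0 <= (n + 16).*2.+1%:R^-1 :> R by rewrite invr_ge0.
by set u := _^-1; lra.
Qed.

Lemma sum_inv_odd_sqr_le a b : (0 < a)%N ->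
  \sum_(a <= i < b) (i.*2.+3%:R ^+ 2)^-1 <= a%:R^-1 :> R.
Proof.
move=> a0; case: (leqP a b) => [ab|/ltnW ba]; last by rewrite big_geq ?invr_ge0.
suff : \sum_(a <= i < b) (i.*2.+3%:R ^+ 2)^-1 <= a%:R^-1 - b%:R^-1 :> R.
  by move=> /le_trans; apply; rewrite gerBl invr_ge0.
rewrite -(subnKC ab); elim: (b - a)%N => [|k IH].
  by rewrite addn0 big_geq // subrr.
rewrite addnS big_nat_recr ?leq_addr //= (le_trans (lerD IH (lexx _))) //.
have i0 : 0 < (a + k)%:R :> R by rewrite ltr0n addn_gt0 a0.
rewrite -muln2 -!natr1 natrM; set i := (a + k)%:R in i0 *.
have -> : (i + 1)^-1 = i^-1 - (i * (i + 1))^-1 by field; rewrite !gt_eqF //; lra.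
have : ((i * 2 + 1 + 1 + 1) ^+ 2)^-1 <= (i * (i + 1))^-1.
  by rewrite lef_pV2 ?posrE ?exprn_gt0 ?mulr_gt0 //; nra.
by lra.
Qed.
End HarmonicBounds.

Section SquarefreeValues.

Definition squarefree m := forall q, prime q -> ~~ (q ^ 2 %| m)%N.

Lemma squarefree_odd_bounded v J : odd v -> (v <= J ^ 2)%N ->
    (forall i, (i < J)%N -> prime i.*2.+3 -> ~~ (i.*2.+3 ^ 2 %| v)%N) ->
  squarefree v.
Proof.
move=> odd_v vJ no_square q qp; apply/negP => qv.
have odd_q : odd q.
  case: (even_prime qp) => // q2; have : (2 %| v)%N by apply: dvdn_trans qv; rewrite q2.
  by rewrite dvdn2 odd_v.
have qE : q = (q - 3)./2.*2.+3.
  by have := odd_prime_gt2 odd_q qp; have := odd_double_half q; rewrite odd_q; lia.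
have qJ : (q <= J)%N.
  rewrite -(@leq_exp2r _ _ 2) // (leq_trans (dvdn_leq _ qv)) //.
  by case: (v) odd_v.
have i_lt : ((q - 3)./2 < J)%N by lia.
by have := no_square _ i_lt; rewrite -qE qv => /(_ qp).
Qed.

Variable R : realFieldType.
Variables A B : nat.
Hypothesis coprime_AB : coprime A B.

Lemma affine_dvd_eqmod m n n' :
  (m %| A * n + B)%N -> (m %| A * n' + B)%N -> n == n' %[mod m].
Proof.
wlog le_n : n n' / (n' <= n)%N.
  by move=> W mn mn'; case: (leqP n' n) => [|/ltnW] le; [|rewrite eq_sym]; exact: W.
move=> mn mn'; have mA : coprime m A.
  rewrite /coprime -dvdn1 -(eqP coprime_AB) dvdn_gcd dvdn_gcdr /=.
  by rewrite -(dvdn_addr _ (dvdn_mulr n (dvdn_gcdr m A))) (dvdn_trans (dvdn_gcdl _ _)).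
rewrite eqn_mod_dvd // -(Gauss_dvdr _ mA) mulnBr.
by rewrite -(subnDr B) dvdn_sub.
Qed.

Definition square_dvd_count N D q :=
  (\sum_(0 <= n < N | [&& prime n, D < n & q ^ 2 %| A * n + B]) 1)%N.

Lemma square_dvd_count_le N D q (c : R) : 0 <= c ->
    (forall r, \sum_(0 <= n < N | [&& n == r %[mod q ^ 2], prime n & (D < n)%N]) 1
       <= c) ->
  (square_dvd_count N D q)%:R <= c.
Proof.
move=> c0 class_le; rewrite /square_dvd_count natr_sum.
case: (boolP (has (fun r => q ^ 2 %| A * r + B)%N (iota 0 N))).
  move=> /hasP[r _ rq]; apply: le_trans (class_le r).
  rewrite big_mkcond [leRHS]big_mkcond; apply: ler_sum => n _.
  case: ifP => [/and3P[-> -> /affine_dvd_eqmod ->] //|_]; last by case: ifP.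
move=> /hasPn none; rewrite big_nat_cond big_pred0 // => n.
apply/negP => /andP[/andP[_ nN] /and3P[_ _]].
by apply/negP/none; rewrite mem_iota.
Qed.

Lemma square_dvd_count_le_sieve N D w q : prime q -> (0 < D < 2 ^ w)%N ->
  (square_dvd_count N D q)%:R
    <= N%:R / harmonic R D * (q%:R * (q%:R - 1))^-1
       + ('C(w.+2, 2) * D)%:R ^+ 2.
Proof.
move=> qp Dw; have H0 := harmonic_ge0 R D.
have q1 := ltW (pred_natr_gt0 R qp).
apply: square_dvd_count_le => [|r].
  by rewrite addr_ge0 ?sqr_ge0 // mulr_ge0 ?divr_ge0 // invr_ge0 mulr_ge0.
have q20 : (0 < q ^ 2)%N by rewrite expn_gt0 prime_gt0.
apply: le_trans (brun_titchmarsh R N r q20 Dw) _.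
rewrite totient_pfactor // expn1 natrM -subn1 natrB ?prime_gt0 //.
by rewrite (mulrC (_ - _)) [_ * harmonic _ _]mulrC invfM mulrA.
Qed.

Lemma square_dvd_count_le_trivial N D q : (0 < q)%N ->
  (square_dvd_count N D q)%:R <= N%:R * (q%:R ^+ 2)^-1 + 1 :> R.
Proof.
move=> q0; apply: square_dvd_count_le => [|r].
  by rewrite addr_ge0 // divr_ge0 ?sqr_ge0.
have q20 : (0 < q ^ 2)%N by rewrite expn_gt0 q0.
have := le_trans (ler_norm _) (count_eqmod_approx R N r q20).
rewrite lerBlDl natrX addrC; apply: le_trans.
rewrite big_mkcond [leRHS]big_mkcond; apply: ler_sum => n _.
by case: (n == r %[mod q ^ 2]) => //=; case: ifP.
Qed.

Lemma sum_square_dvd_count_le N D w I J : (0 < D < 2 ^ w)%N -> (0 < I <= J)%N ->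
  (\sum_(0 <= i < J | prime i.*2.+3) square_dvd_count N D i.*2.+3)%:R
    <= N%:R / harmonic R D * (13 / 40) + I%:R * ('C(w.+2, 2) * D)%:R ^+ 2
       + N%:R / I%:R + J%:R.
Proof.
move=> Dw /andP[I0 IJ]; rewrite natr_sum (@big_cat_nat _ _ _ I) //= -[leRHS]addrA.
set E := _ ^+ 2; have H0 := harmonic_ge0 R D.
apply: lerD.
  apply: (@le_trans _ _ (\sum_(0 <= i < I)
      (N%:R / harmonic R D * (i.*2.+3%:R * (i.*2.+3%:R - 1))^-1 + E))).
    rewrite big_mkcond; apply: ler_sum => i _; case: ifP => [qp|_].
      exact: square_dvd_count_le_sieve.
    rewrite addr_ge0 ?sqr_ge0 // mulr_ge0 ?divr_ge0 // invr_ge0 mulr_ge0 //.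
    by rewrite subr_ge0 ler1n.
  rewrite big_split /= -mulr_sumr sumr_const_nat subn0 -[E *+ I]mulr_natl lerD2r.
  by rewrite ler_wpM2l ?divr_ge0 ?sum_inv_odd_mul_pred_le.
apply: (@le_trans _ _ (\sum_(I <= i < J) (N%:R * (i.*2.+3%:R ^+ 2)^-1 + 1))).
  rewrite big_mkcond; apply: ler_sum => i _; case: ifP => _.
    exact: square_dvd_count_le_trivial.
  by rewrite addr_ge0 // divr_ge0 ?sqr_ge0.
rewrite big_split /= -mulr_sumr lerD ?ler_wpM2l ?sum_inv_odd_sqr_le //.
by rewrite sumr_const_nat ler_nat leq_subr.
Qed.

Lemma exists_prime_no_square_dvd N D J :
    (D.+1 + \sum_(0 <= i < J | prime i.*2.+3) square_dvd_count N D i.*2.+3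
       < prime_count N)%N ->
  exists n, [/\ (D < n < N)%N, prime n
    & forall i, (i < J)%N -> prime i.*2.+3 -> ~~ (i.*2.+3 ^ 2 %| A * n + B)%N].
Proof.
move=> few_bad; pose bad n i := prime i.*2.+3 && (i.*2.+3 ^ 2 %| A * n + B)%N.
pose good n := [&& prime n, D < n & ~~ has (bad n) (iota 0 J)]%N.
case: (boolP (has good (iota 0 N))).
  move=> /hasP[n]; rewrite mem_iota => nN /and3P[pn Dn /hasPn nbad].
  exists n; split=> [||i iJ qp] //; first by rewrite Dn.
  by have := nbad i; rewrite mem_iota /bad qp => /(_ iJ).
move=> /hasPn all_bad; move: few_bad; rewrite ltnNge => /negP[].
have {}all_bad n : (n < N)%N -> prime n -> (D < n)%N -> has (bad n) (iota 0 J).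
  by move=> nN pn Dn; have := all_bad n; rewrite mem_iota /good pn Dn negbK => /(_ nN).
rewrite /prime_count /square_dvd_count.
under [X in (_ <= _ + X)%N]eq_bigr => i _ do rewrite big_mkcond.
rewrite exchange_big /=; apply: leq_trans (leq_add (geq_minr N D.+1) (leqnn _)).
rewrite -sum_ltn_minn -big_split big_mkcond /= big_nat [leqRHS]big_nat.
apply: leq_sum => n /andP[_ nN]; case: ifP => // pn.
rewrite ltnS; case: (leqP n D) => // Dn.
have /hasP[i] := all_bad n nN pn Dn; rewrite mem_iota => iJ /andP[qp qv].
by rewrite (big_rem i) ?mem_index_iota //= qp qv addnA addn1.
Qed.
End SquarefreeValues.

Lemma bin2_24_le l : (0 < l)%N -> ('C((24 * l).+3, 2) <= 351 * l ^ 2)%N.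
Proof.
by move=> l0; rewrite bin2 -[leqRHS]doubleK half_leq //= -mul2n -mulnn; nia.
Qed.

(* With [y = 2 ^ l], the left-hand side collects every term of the count that is of
   smaller order than [y ^ 49 / l]. *)
Lemma sieve_error_le C M l y : (0 < l)%N -> (0 < y)%N ->
  ((y ^ 24).+2 + M * l * ('C((24 * l).+3, 2) * y ^ 24) ^ 2 + (M * l + C * y ^ 25)
    <= (3 + 351 ^ 2 * M + M + C) * (l ^ 5 * y ^ 48))%N.
Proof.
move=> l0 y0; have pow_le e f : (e <= 5)%N -> (f <= 48)%N ->
    (l ^ e * y ^ f <= l ^ 5 * y ^ 48)%N by move=> e5 f48; rewrite leq_mul ?leq_pexp2l.
have const_le := pow_le 0%N 0%N isT isT; have D_le := pow_le 0%N 24%N isT isT.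
have Ml_le := leq_mul (leqnn M) (pow_le 1%N 0%N isT isT).
have Cy_le := leq_mul (leqnn C) (pow_le 0%N 25%N isT isT).
have sq_le : (M * l * ('C((24 * l).+3, 2) * y ^ 24) ^ 2
    <= 351 ^ 2 * M * (l ^ 5 * y ^ 48))%N.
  have -> : (351 ^ 2 * M * (l ^ 5 * y ^ 48) = M * l * (351 * l ^ 2 * y ^ 24) ^ 2)%N.
    by rewrite (expnMn (_ * _)) (expnMn 351) -!expnM [(l ^ 5)%N]expnS; lia.
  by rewrite leq_mul2l leq_exp2r // leq_mul2r bin2_24_le ?orbT.
move: sq_le const_le D_le Ml_le Cy_le; rewrite !expn0 expn1 !mul1n !muln1.
move: (351 ^ 2)%N (y ^ 24)%N (y ^ 25)%N (l ^ 5 * y ^ 48)%N => K D Y T.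
by move: (_ ^ 2)%N => E; rewrite !mulnDl; lia.
Qed.

Section AsymptoticCount.
Variable R : realFieldType.
Variables A B M l : nat.
Hypothesis coprime_AB : coprime A B.
Hypotheses (M_large : 100 * 100 <= M%:R :> R) (l_gt0 : (0 < l)%N).
Hypothesis l_large : (M * (3 + 351 ^ 2 * M + M + (A + B)) * l ^ 6 <= 2 ^ l)%N.

Let N := (2 ^ (49 * l))%N.
Let D := (2 ^ (24 * l))%N.
Let I := (M * l)%N.
Let J := (I + (A + B) * 2 ^ (25 * l))%N.
Let x : R := N%:R / l%:R.

Let l_gt0_R : 0 < l%:R :> R. Proof. by rewrite ltr0n. Qed.

Let xE : x * l%:R = N%:R. Proof. by rewrite divfK ?gt_eqF. Qed.

Lemma error_terms_le :
  (D.+2 + I * ('C((24 * l).+3, 2) * D) ^ 2 + J)%:R * M%:R <= x.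
Proof.
have := l_large; set y := (2 ^ l)%N; set K := (3 + _ + _ + _)%N => MKl_le.
have powE c : (2 ^ (c * l) = y ^ c)%N by rewrite mulnC expnM.
rewrite ler_pdivlMr // -!natrM ler_nat /J /D /N /I !powE.
apply: (@leq_trans (K * (l ^ 5 * y ^ 48) * M * l)).
  by rewrite !leq_mul2r sieve_error_le ?orbT // expn_gt0.
have -> : (K * (l ^ 5 * y ^ 48) * M * l = M * K * l ^ 6 * y ^ 48)%N.
  by rewrite (expnS l 5); ring.
by rewrite (expnS y 48) leq_mul2r MKl_le orbT.
Qed.

Lemma harmonic_terms_le : N%:R / harmonic R D <= x * (5 / 81).
Proof.
have D0 : (0 < D)%N by rewrite expn_gt0.
have l24 : (4 <= 24 * l)%N by lia.
have H_ge := harmonic_pow2_ge R l24.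
rewrite ler_pdivrMr ?harmonic_gt0 // -xE -[leRHS]mulrA ler_wpM2l ?divr_ge0 //.
by move: H_ge; rewrite -/D natrM; lra.
Qed.

Lemma prime_count_ge : x / 49 - 1 <= (prime_count N)%:R.
Proof.
have l49 : (1 < 49 * l)%N by lia.
have := prime_count_pow2_ge l49; rewrite -(ler_nat R) -/N -xE mulnAC natrM ler_pM2r //.
by rewrite natrM -[(prime_count _).+1%:R]natr1; lra.
Qed.

(* At least [N / (49 * l)] numbers below [N] are prime, up to lower order terms, and at
   most [13 / 40 * N / (27 / 40 * 24 * l)] of these are hit by the square of an odd
   prime: all rests on [13 * 49 < 27 * 24]. *)
Lemma sum_square_dvd_count_lt_prime_count :
  (D.+1 + \sum_(0 <= i < J | prime i.*2.+3) square_dvd_count A B N D i.*2.+3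
    < prime_count N)%N.
Proof.
have Dw : (0 < D < 2 ^ (24 * l).+1)%N by rewrite expn_gt0 ltn_exp2l ?ltnSn.
have M0 : 0 < M%:R :> R by apply: lt_le_trans M_large; lra.
have IJ : (0 < I <= J)%N by rewrite muln_gt0 -(ltr0n R) M0 l_gt0 leq_addr.
have bad_le := sum_square_dvd_count_le R coprime_AB N Dw IJ.
have div_M t : 0 <= t -> t * M%:R <= x -> t * (100 * 100) <= x.
  by move=> t0; apply: le_trans; rewrite ler_wpM2l.
have errors_le := div_M _ (ler0n _ _) error_terms_le.
have tail_le : N%:R / I%:R * (100 * 100) <= x.
  rewrite div_M ?divr_ge0 // le_eqVlt /x natrM; apply/orP; left; apply/eqP; field.
  by rewrite !lt0r_neq0.
have x0 : 0 < x by rewrite divr_gt0 // ltr0n expn_gt0.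
rewrite -(ltr_nat R) natrD; apply: le_lt_trans (lerD (lexx _) bad_le) _.
move: errors_le tail_le harmonic_terms_le prime_count_ge.
rewrite -[D.+2]addn2 -[D.+1]addn1 !natrD (natrM _ I) natrX.
move: (_ ^+ 2) (N%:R / I%:R) (N%:R / harmonic R D) (prime_count N)%:R => E u v P.
by move: (I%:R * E) ((_ * 2 ^ _)%N%:R) => e j; lra.
Qed.

End AsymptoticCount.

Theorem infinitely_many_primes_squarefree A B N0 : coprime A B ->
    (forall n, odd n -> odd (A * n + B)) ->
  exists p, [/\ (N0 < p)%N, prime p & squarefree (A * p + B)].
Proof.
move=> coprime_AB odd_AB.
have [M M_large] : exists M, 100 * 100 <= M%:R :> rat.
  by exists (100 * 100)%N; rewrite natrM lexx.
have [l lN0 l_large] := exists_pow2_ge (M * (3 + 351 ^ 2 * M + M + (A + B))) 6 N0.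
have l0 : (0 < l)%N by exact: leq_ltn_trans lN0.
have {M_large l_large} few_bad :=
  sum_square_dvd_count_lt_prime_count coprime_AB M_large l0 l_large.
have {few_bad}[n [/andP[Dn nN] pn no_square]] := exists_prime_no_square_dvd few_bad.
have n_gtN0 : (N0 < n)%N.
  apply: leq_ltn_trans Dn; rewrite (leq_trans (ltnW lN0)) //.
  by rewrite (leq_trans (ltnW (ltn_expl l (ltnSn 1)))) // leq_exp2l // leq_pmull.
have n_gt2 : (2 < n)%N.
  by apply: leq_ltn_trans Dn; rewrite -{1}(expn1 2) leq_exp2l // muln_gt0.
have odd_n : odd n by case: (even_prime pn) n_gt2 => // ->.
exists n; split; [exact: n_gtN0 | exact: pn |].
apply: squarefree_odd_bounded (odd_AB n odd_n) _ no_square.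
apply: (@leq_trans (((A + B) * 2 ^ (25 * l)) ^ 2)); last by rewrite leq_exp2r // leq_addl.
apply: (@leq_trans ((A + B) * 2 ^ (49 * l))).
  by rewrite mulnDl leq_add ?leq_mul2l ?(ltnW nN) ?orbT // leq_pmulr // expn_gt0.
rewrite expnMn -expnM leq_mul //; first by case: (A + B)%N => // s; rewrite leq_pmulr.
by rewrite leq_exp2l //; lia.
Qed.

(** * Dedekind's criterion *)

Lemma exists_irreducible_factor (F : finFieldType) (p : {poly F}) :
  (1 < size p)%N -> exists2 g : {poly F}, irreducible_poly g & g %| p.
Proof.
have [k] := ubnP (size p); elim: k p => // k IH p pk p1.
case: (boolP (irreducibleb p)) => [/irreducibleP|]; first by exists p.
rewrite negb_and p1 /= negb_forall => /existsP[g].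
rewrite negb_imply -ltnNge -Pdiv.Idomain.dvdpE => /andP[gp g1].
have gk : (size (g : {poly F}) < k)%N.
  by apply: leq_ltn_trans (size_npoly g) _; rewrite -ltnS prednK // (ltnW p1).
by have [h irr_h hg] := IH _ gk g1; exists h => //; exact: dvdp_trans gp.
Qed.

Lemma map_poly_ratr_intr (R : numFieldType) (p : {poly int}) :
  map_poly ratr (map_poly intr p : {poly rat}) = map_poly intr p :> {poly R}.
Proof.
by rewrite -map_poly_comp; apply: eq_map_poly => z; rewrite /= rmorph_int.
Qed.

Section Reduction.
Variable q : nat.
Hypothesis q_prime : prime q.

Definition polymod : {poly int} -> {poly 'F_q} := map_poly intr.
HB.instance Definition _ := GRing.RMorphism.copy polymod (map_poly intr).

Definition polylift (p : {poly 'F_q}) : {poly int} :=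
  map_poly (fun x : 'F_q => (x : nat)%:Z) p.

Lemma polyliftK : cancel polylift polymod.
Proof.
move=> p; apply/polyP => i; rewrite coef_map /= coef_map_id0 //.
by rewrite -pmulrn natr_Zp.
Qed.

Lemma intr_Fp_eq0 (z : int) : (z%:~R == 0 :> 'F_q) = (q %| z)%Z.
Proof. by rewrite (dvdz_pcharf (pchar_Fp q_prime)). Qed.

Lemma polymod_eq p p' : polymod p = polymod p' -> exists s, p = p' + q%:Z *: s.
Proof.
move=> /eqP; rewrite -subr_eq0 -rmorphB => /eqP pp'0.
exists (map_poly (divz^~ q%:Z) (p - p')); rewrite map_poly_divzK ?subrKC //.
apply/polyOverP => i; rewrite -intr_Fp_eq0.
have := coef_map (intr : int -> 'F_q) (p - p') i.
by rewrite [map_poly _ _]pp'0 coef0 => ->.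
Qed.

Lemma polymodZq p : polymod (q%:Z *: p) = 0.
Proof.
rewrite /polymod map_polyZ /= (_ : _%:~R = 0) ?scale0r //.
by apply/eqP; rewrite intr_Fp_eq0.
Qed.

Lemma polymod_horner p (c : int) : (polymod p).[c%:~R] = (p.[c])%:~R.
Proof. exact: horner_map. Qed.

Lemma polymod_root_dvd p (g : {poly 'F_q}) (c : int) :
  root g c%:~R -> g %| polymod p -> (q%:Z %| p.[c])%Z.
Proof.
move=> gc /dvdpP[k pE]; rewrite -intr_Fp_eq0 -polymod_horner pE hornerM.
by rewrite (rootP gc) mulr0.
Qed.
End Reduction.

Section IntegerPolynomialValues.
Variable theta : algC.

Definition evalZ : {poly int} -> algC := horner_eval theta \o map_poly intr.
HB.instance Definition _ :=
  GRing.RMorphism.copy evalZ (horner_eval theta \o map_poly intr).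

Lemma evalZC (c : int) : evalZ c%:P = c%:~R.
Proof. by rewrite /evalZ /= map_polyC /horner_eval hornerC. Qed.

Lemma evalZZ (c : int) g : evalZ (c *: g) = c%:~R * evalZ g.
Proof. by rewrite -mul_polyC rmorphM /= evalZC. Qed.

Definition in_Zadjoin (x : algC) := exists g, x = evalZ g.

Lemma in_Zadjoin_eval g : in_Zadjoin (evalZ g). Proof. by exists g. Qed.

Lemma in_Zadjoin_int (c : int) : in_Zadjoin c%:~R.
Proof. by exists c%:P; rewrite evalZC. Qed.

Lemma in_ZadjoinD x y : in_Zadjoin x -> in_Zadjoin y -> in_Zadjoin (x + y).
Proof. by move=> [g ->] [h ->]; exists (g + h); rewrite rmorphD. Qed.

Lemma in_ZadjoinN x : in_Zadjoin x -> in_Zadjoin (- x).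
Proof. by move=> [g ->]; exists (- g); rewrite rmorphN. Qed.

Lemma in_ZadjoinM x y : in_Zadjoin x -> in_Zadjoin y -> in_Zadjoin (x * y).
Proof. by move=> [g ->] [h ->]; exists (g * h); rewrite rmorphM. Qed.

Lemma in_ZadjoinX x k : in_Zadjoin x -> in_Zadjoin (x ^+ k).
Proof. by move=> [g ->]; exists (g ^+ k); rewrite rmorphXn. Qed.

Lemma minCpoly_int x : x \in Aint -> exists2 p : {poly int},
  p \is monic & map_poly intr p = minCpoly x.
Proof.
move=> /floorpP[p pE]; exists p => //.
have := minCpoly_monic x; rewrite pE !monicE lead_coef_map_inj //; last exact: intr_inj.
by rewrite -[1 in X in X -> _]/(1%:~R) eqr_int.
Qed.

(* Multiplying an integral equation of degree k for y by t^(k-1) gives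
   y (y t)^(k-1) in Z[theta], and y t = 1 modulo s, which y maps into Z[theta]. *)
Lemma in_Zadjoin_of_integral y t s : y \in Aint -> in_Zadjoin t -> in_Zadjoin s ->
  y * t = 1 + s -> in_Zadjoin (y * s) -> in_Zadjoin y.
Proof.
move=> yA Zt Zs yt Zys; have Z1 := in_Zadjoin_int 1.
have descent k : in_Zadjoin (y * (1 + s) ^+ k) -> in_Zadjoin y.
  elim: k => [|k IH]; rewrite ?mulr1 // => Zk; apply: IH.
  have -> : y * (1 + s) ^+ k = y * (1 + s) ^+ k.+1 + - (y * s * (1 + s) ^+ k).
    by rewrite exprS; ring.
  by apply: in_ZadjoinD Zk _; apply/in_ZadjoinN/in_ZadjoinM/in_ZadjoinX/in_ZadjoinD.
have [p p_monic pE] := minCpoly_int yA.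
have := root_minCpoly y; have := size_minCpoly y; rewrite -pE rootE horner_coef.
rewrite size_map_inj_poly //; last exact: intr_inj.
have := monicP p_monic; rewrite /lead_coef; case: (size p) => [|[|k]] //= lead_p _.
rewrite big_ord_recr /= coef_map /= lead_p mulr1z mul1r addrC addr_eq0 => /eqP yk.
apply: (descent k); rewrite -yt exprMn mulrA -exprS yk mulNr; apply: in_ZadjoinN.
rewrite mulr_suml; elim/big_rec: _ => [|i x _ Zx]; first exact: (in_Zadjoin_int 0).
apply: in_ZadjoinD Zx; have ik : (i <= k)%N by rewrite -ltnS.
have -> : (map_poly intr p)`_i * y ^+ i * t ^+ k
    = (p`_i)%:~R * ((y * t) ^+ i * t ^+ (k - i)).
  have tk : t ^+ k = t ^+ i * t ^+ (k - i) by rewrite -exprD subnKC.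
  by rewrite coef_map tk exprMn; ring.
apply/in_ZadjoinM/in_ZadjoinM; [exact: in_Zadjoin_int | | exact: in_ZadjoinX].
by rewrite yt; exact/in_ZadjoinX/in_ZadjoinD.
Qed.
End IntegerPolynomialValues.

Section MonogenicOrder.
Variables (f : {poly int}) (theta : algC).
Hypothesis f_monic : f \is monic.
Hypothesis f_irr : irreducible_poly (map_poly intr f : {poly rat}).
Hypothesis f_theta : root (map_poly intr f) theta.

Local Notation evalZ := (evalZ theta).
Local Notation in_Zadjoin := (in_Zadjoin theta).

Lemma root_ratpoly_dvdp (g : {poly rat}) :
  root (map_poly ratr g) theta = (map_poly intr f %| g).
Proof.
have [p [pE p_monic] p_dvd] := minCpolyP theta; rewrite p_dvd; apply: eqp_dvdl.
apply: (apply_irredp f_irr); last by rewrite -p_dvd map_poly_ratr_intr.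
by have := size_minCpoly theta; rewrite pE size_map_poly; case: (size p) => [|[]].
Qed.

Lemma minCpoly_monic_irreducible : minCpoly theta = map_poly intr f.
Proof.
have [p [pE p_monic] p_dvd] := minCpolyP theta.
rewrite pE -map_poly_ratr_intr; congr map_poly; apply/eqP.
rewrite -eqp_monic ?monic_map // /eqp -p_dvd -root_ratpoly_dvdp.
by rewrite map_poly_ratr_intr f_theta -pE root_minCpoly.
Qed.

Lemma evalZ_root : evalZ f = 0. Proof. exact/eqP. Qed.

Lemma evalZ_eq0 g : evalZ g = 0 -> exists k, g = k * f.
Proof.
move=> g0; have gE := Pdiv.RingMonic.rdivp_eq f_monic g.
set k := Pdiv.CommonRing.rdivp _ _ in gE; set r := Pdiv.CommonRing.rmodp _ _ in gE.
exists k; rewrite gE; suff -> : r = 0 by rewrite addr0.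
have size_r : (size r < size f)%N by rewrite Pdiv.CommonRing.ltn_rmodp monic_neq0.
have inj : injective (intr : int -> rat) by exact: intr_inj.
have : map_poly intr f %| (map_poly intr r : {poly rat}).
  rewrite -root_ratpoly_dvdp map_poly_ratr_intr rootE -[_.[_]]/(evalZ r).
  by move: g0; rewrite gE rmorphD rmorphM /= evalZ_root mulr0 add0r => ->.
apply: contraTeq => r0; apply: contraL size_r => /dvdp_leq.
rewrite !size_map_inj_poly // -leqNgt; apply.
by rewrite -size_poly_eq0 size_map_inj_poly // size_poly_eq0.
Qed.

Lemma Aint_root : theta \in Aint.
Proof.
apply: root_monic_Aint f_theta _ _; first by rewrite monic_map.
by apply/polyOverP => i; rewrite coef_map /= intr_int.
Qed.

Lemma Aint_Zadjoin x : in_Zadjoin x -> x \in Aint.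
Proof.
move=> [g ->]; rewrite /evalZ /= /horner_eval horner_coef rpred_sum // => i _.
by rewrite rpredM ?rpredX ?Aint_root // coef_map /= Aint_int.
Qed.

Definition maximal_at (q : nat) := forall x,
  x \in Aint -> in_Zadjoin (q%:R * x) -> in_Zadjoin x.

Lemma in_Zadjoin_of_multiple m x : (0 < m)%N -> (forall q, prime q -> maximal_at q) ->
  x \in Aint -> in_Zadjoin (m%:R * x) -> in_Zadjoin x.
Proof.
move=> + maximal; elim/ltn_ind: m x => m IH x m0 xA.
case: (ltngtP m 1%N) => [|m1|->]; [by rewrite ltnNge m0 | | by rewrite mul1r].
have /dvdnP[k mE] := pdiv_dvd m; set q := pdiv m in mE.
have qp : prime q by exact: pdiv_prime.
have k0 : (0 < k)%N by move: m0; rewrite mE muln_gt0 => /andP[].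
rewrite mE natrM -mulrA => Zqx; apply: (maximal q qp) => //.
by apply: IH Zqx; rewrite // ?mE ?ltn_Pmulr ?prime_gt1 // rpredM ?rpred_nat.
Qed.

Lemma in_Qadjoin_multiple x : in_Qadjoin theta x ->
  exists2 m, (0 < m)%N & in_Zadjoin (m%:R * x).
Proof.
move=> [a [b [b0 xE]]].
have cop : coprimep (map_poly intr f) b.
  by rewrite irreducible_poly_coprime // -root_ratpoly_dvdp.
have [[u v] /= uv] := Bezout_eq1_coprimepP _ _ cop.
have vb : (map_poly ratr v).[theta] * (map_poly ratr b).[theta] = 1.
  have /(congr1 (fun p => (map_poly ratr p).[theta] : algC)) := uv.
  rewrite rmorphD !rmorphM /= rmorph1 hornerD !hornerM hornerC.
  by rewrite map_poly_ratr_intr (rootP f_theta) mulr0 add0r.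
have [g [d d0 gE]] := rat_poly_scale (a * v).
have {}xE : d%:~R * x = evalZ g.
  have -> : x = (map_poly ratr (a * v)).[theta].
    by rewrite xE rmorphM hornerM; apply: (mulIf b0); rewrite divfK // -mulrA vb mulr1.
  rewrite gE map_polyZ hornerZ map_poly_ratr_intr fmorphV /= rmorph_int mulVKf //.
  by rewrite intr_eq0.
exists `|d|%N; first by rewrite absz_gt0.
case: d {d0 gE} xE => k xE; first by exists g.
by exists (- g); rewrite rmorphN /= -xE NegzE rmorphN mulNr opprK.
Qed.

Lemma evalZ_small (r : {poly int}) : (size r <= (size f).-1)%N ->
  evalZ r = \sum_(i < (size f).-1) (r`_i)%:~R * theta ^+ i.
Proof.
move=> size_r; rewrite /evalZ /= /horner_eval (@horner_coef_wide _ (size f).-1).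
  by apply: eq_bigr => i _; rewrite coef_map.
by rewrite (leq_trans (size_poly _ _)).
Qed.

Lemma is_Zbasis_powers : (forall q, prime q -> maximal_at q) ->
  is_Zbasis (fun i : 'I_(size f).-1 => theta ^+ i) (in_ring_of_integers theta).
Proof.
move=> maximal; have f0 : (0 < size f)%N by rewrite size_poly_gt0 monic_neq0.
split=> [i|x [Qx xA]|c c0 i].
- split; last by rewrite rpredX ?Aint_root.
  exists 'X^i, 1; rewrite rmorph1 hornerC oner_neq0; split=> //.
  by rewrite divr1 map_polyXn hornerXn.
- have [m m0 Zmx] := in_Qadjoin_multiple Qx.
  have [g ->] := in_Zadjoin_of_multiple m0 maximal xA Zmx.
  exists (fun i => (Pdiv.CommonRing.rmodp g f)`_i); rewrite -evalZ_small.
    by rewrite [in LHS](Pdiv.RingMonic.rdivp_eq f_monic g) rmorphD rmorphM /= evalZ_root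
      mulr0 add0r.
  by rewrite -ltnS prednK // Pdiv.CommonRing.ltn_rmodp monic_neq0.
- pose r := \poly_(i < (size f).-1) (if insub i is Some j then c j else 0).
  have rE (j : 'I_(size f).-1) : r`_j = c j by rewrite coef_poly ltn_ord valK.
  have size_r : (size r <= (size f).-1)%N by exact: size_poly.
  have /evalZ_eq0[k rk] : evalZ r = 0.
    by rewrite evalZ_small // -[RHS]c0; apply: eq_bigr => j _; rewrite rE.
  rewrite -rE; suff -> : r = 0 by rewrite coef0.
  apply/eqP; apply: contraTT size_r => r0; rewrite -ltnNge prednK // rk.
  have k0 : k != 0 by apply: contraNneq r0 => k0; rewrite rk k0 mul0r.
  by rewrite size_Mmonic // -(prednK (n := size k)) ?size_poly_gt0 // addSn /= leq_addl.
Qed.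
End MonogenicOrder.

Section DedekindCriterion.
Variables (f : {poly int}) (theta : algC) (q : nat).
Hypothesis f_monic : f \is monic.
Hypothesis f_irr : irreducible_poly (map_poly intr f : {poly rat}).
Hypothesis f_theta : root (map_poly intr f) theta.
Hypothesis q_prime : prime q.

Local Notation evalZ := (evalZ theta).
Local Notation in_Zadjoin := (in_Zadjoin theta).

Let q_neq0 : q%:R != 0 :> algC.
Proof. by rewrite pnatr_eq0 -lt0n prime_gt0. Qed.

(* Modulo q, the gcd d of f and g is a proper divisor of f = e d. With P an irreducible
   factor of e and h = (e / P) d, the value h(theta) is a combination of f(theta) = 0 and
   of g(theta), hence divisible by q. *)
Lemma integral_quotient_of_nonmaximal g x : x \in Aint -> q%:R * x = evalZ g ->
    ~~ (polymod q f %| polymod q g) ->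
  exists P h F, [/\ f = P * h + q%:Z *: F, irreducible_poly (polymod q P)
    & evalZ h / q%:R \in Aint].
Proof.
set fb := polymod q f; set gb := polymod q g => xA xE f_ndvd_g.
have fb0 : fb != 0 by rewrite monic_neq0 // monic_map.
set d := gcdp gb fb; set e := fb %/ d.
have fE : e * d = fb by rewrite divpK // dvdp_gcdr.
have e_gt1 : (1 < size e)%N.
  rewrite ltnNge; apply: contra f_ndvd_g => /size1_polyC eC.
  have c0 : e`_0 != 0 by apply: contraNneq fb0 => c0; rewrite -fE eC c0 mul0r.
  by rewrite -fE eC mul_polyC dvdpZl // dvdp_gcdl.
have [r r_irr /dvdpP[e' eE]] := exists_irreducible_factor e_gt1.
have [[u v] /= /andP[/dvdpP[w dE] _]] := Bezoutp gb fb.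
pose P := polylift r; pose h := polylift (e' * d).
have [F FE] : exists F, f = P * h + q%:Z *: F.
  by apply: polymod_eq => //; rewrite rmorphM /= !polyliftK -/fb -fE eE; ring.
have [s hE] : exists s,
    h = polylift (e' * w * u) * g + polylift (e' * w * v) * f + q%:Z *: s.
  apply: polymod_eq => //; rewrite rmorphD !rmorphM /= !polyliftK -/gb -/fb /d dE.
  by ring.
exists P, h, F; split=> //; first by rewrite polyliftK.
have -> : evalZ h / q%:R = evalZ (polylift (e' * w * u)) * x + evalZ s.
  rewrite hE !rmorphD !rmorphM /= evalZZ -xE (evalZ_root f_theta) -pmulrn.
  by field.
have Aint_eval k : evalZ k \in Aint.
  by apply: Aint_Zadjoin f_monic f_theta _ _; exact: in_Zadjoin_eval.
by rewrite rpredD // rpredM.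
Qed.

Section IntegralQuotient.
Variables P h F : {poly int}.
Hypothesis fE : f = P * h + q%:Z *: F.
Hypothesis P_irr : irreducible_poly (polymod q P).

Let y := evalZ h / q%:R.

Lemma quotient_mulq : y * q%:R = evalZ h. Proof. by rewrite divfK. Qed.

Lemma quotient_mulP : y * evalZ P = - evalZ F.
Proof.
have := evalZ_root f_theta; rewrite fE rmorphD rmorphM /= evalZZ -pmulrn -quotient_mulq.
move=> /eqP; rewrite addr_eq0 => /eqP PyE.
by apply: (mulIf q_neq0); rewrite mulNr [_ * q%:R in RHS]mulrC -PyE; ring.
Qed.

Lemma quotient_notin_Zadjoin : ~ in_Zadjoin y.
Proof.
move=> [k yk]; have [k' kE] : exists k', h - q%:Z *: k = k' * f.
  apply: (evalZ_eq0 f_monic f_irr f_theta).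
  by rewrite rmorphB /= evalZZ -pmulrn -yk mulrC quotient_mulq subrr.
have hE : polymod q h = polymod q k' * polymod q P * polymod q h.
  have := congr1 (polymod q) kE.
  rewrite rmorphB rmorphM /= polymodZq // subr0 fE rmorphD rmorphM /= polymodZq // addr0.
  by rewrite mulrA.
have h0 : polymod q h != 0.
  have : polymod q f != 0 by rewrite monic_neq0 // monic_map.
  by apply: contraNneq => h0; rewrite fE rmorphD rmorphM /= h0 polymodZq // mulr0 addr0.
have unitP : 1 = polymod q k' * polymod q P by apply: (mulIf h0); rewrite mul1r.
have : polymod q P %| 1 by rewrite unitP dvdp_mull.
by rewrite dvdp1 => /eqP size_P; case: P_irr => + _; rewrite size_P.
Qed.

(* The ideal (q, P(theta)) is maximal and y multiplies it into Z[theta]; were y t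
   outside it, y would lie in Z[theta]. *)
Lemma dvdp_mod_quotient_mul t r : y \in Aint -> in_Zadjoin t -> y * t = evalZ r ->
  polymod q P %| polymod q r.
Proof.
move=> yA Zt yt; apply: (contra_notT _ quotient_notin_Zadjoin).
rewrite -irreducible_poly_coprime // => /Bezout_eq1_coprimepP[[u v] /= uv].
have [s sE] : exists s, polylift u * P + polylift v * r = 1 + q%:Z *: s.
  by apply: polymod_eq => //; rewrite rmorphD !rmorphM rmorph1 /= !polyliftK.
have Zeval := in_Zadjoin_eval theta.
have evalE := congr1 evalZ sE.
rewrite !rmorphD !rmorphM rmorph1 /= evalZZ -pmulrn in evalE.
apply: (in_Zadjoin_of_integral (t := t * evalZ (polylift v))
  (s := q%:R * evalZ s - evalZ (polylift u) * evalZ P)) => //.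
- exact: in_ZadjoinM.
- by apply/in_ZadjoinD/in_ZadjoinN/in_ZadjoinM => //; apply: in_ZadjoinM => //;
    exact: (in_Zadjoin_int _ q).
- by rewrite mulrA yt addrA -evalE; ring.
- rewrite mulrBr mulrA quotient_mulq mulrCA quotient_mulP mulrN opprK.
  by apply: in_ZadjoinD; exact: in_ZadjoinM.
Qed.
End IntegralQuotient.

Theorem dedekind_maximal_at :
    (forall P h F : {poly int}, f = P * h + q%:Z *: F -> irreducible_poly (polymod q P) ->
       polymod q P %| polymod q h -> ~~ (polymod q P %| polymod q F)) ->
  maximal_at theta q.
Proof.
move=> criterion x xA [g xE].
case: (boolP (polymod q f %| polymod q g)) => [/dvdpP[k gE]|].
  have [s sE] : exists s, g = polylift k * f + q%:Z *: s.
    by apply: polymod_eq => //; rewrite rmorphM /= polyliftK.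
  exists s; apply: (mulfI q_neq0); rewrite xE sE rmorphD rmorphM /= (evalZ_root f_theta).
  by rewrite mulr0 add0r evalZZ -pmulrn.
move=> /(integral_quotient_of_nonmaximal xA xE)[P [h [F [fE P_irr yA]]]].
have Zq : in_Zadjoin q%:R := in_Zadjoin_int theta q.
have Ph := dvdp_mod_quotient_mul fE P_irr yA Zq (quotient_mulq h).
have /negP[] := criterion P h F fE P_irr Ph; rewrite -dvdpNr -rmorphN.
apply: (dvdp_mod_quotient_mul fE P_irr yA (in_Zadjoin_eval theta P)).
by rewrite rmorphN; exact: quotient_mulP.
Qed.

Lemma maximal_at_of_integer_roots :
    (forall g : {poly 'F_q}, irreducible_poly g -> g ^+ 2 %| polymod q f ->
       exists2 c : int, root g c%:~R & ~~ (q%:Z ^+ 2 %| f.[c])%Z) ->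
  maximal_at theta q.
Proof.
move=> criterion; apply: dedekind_maximal_at => P h F fE P_irr Ph; apply/negP => PF.
have [|c Pc /negP[]] := criterion (polymod q P) P_irr.
  by rewrite fE rmorphD rmorphM /= polymodZq // addr0 expr2 dvdp_mul.
rewrite fE hornerD hornerM hornerZ expr2 rpredD // dvdz_mul //;
  by rewrite (polymod_root_dvd _ Pc).
Qed.
End DedekindCriterion.

Lemma monogenic_criterion (f : {poly int}) :
    f \is monic -> irreducible_poly (map_poly intr f : {poly rat}) ->
    (forall q, prime q ->
     forall g : {poly 'F_q}, irreducible_poly g -> g ^+ 2 %| polymod q f ->
       exists2 c : int, root g c%:~R & ~~ (q%:Z ^+ 2 %| f.[c])%Z) ->
  monogenic f.
Proof.
move=> f_monic f_irr criterion; split=> // theta f_theta.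
apply: is_Zbasis_powers => // q qp.
exact: maximal_at_of_integer_roots (criterion q qp).
Qed.

(** * Roots and multiple factors *)

Lemma norm_horner0_gt1 (C : numClosedFieldType) (g : {poly C}) :
    (1 < size g)%N -> `|lead_coef g| = 1 ->
  (forall x, root g x -> 1 < `|x|) -> 1 < `|g.[0]|.
Proof.
move=> size_g lead_g root_gt1; have [rs gE] := closed_field_poly_normal g.
have g0 : lead_coef g != 0 by rewrite -normr_eq0 lead_g oner_neq0.
have rs_gt1 z : z \in rs -> 1 < `|z|.
  by move=> zrs; apply: root_gt1; rewrite gE rootZ // root_prod_XsubC.
have prodE : `|g.[0]| = \prod_(z <- rs) `|z|.
  rewrite gE hornerZ normrM lead_g mul1r horner_prod normr_prod.
  by apply: eq_bigr => z _; rewrite hornerXsubC sub0r normrN.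
have : (0 < size rs)%N.
  by move: size_g; rewrite gE size_scale // size_prod_XsubC.
rewrite prodE; case: rs rs_gt1 {gE prodE} => // z rs /forall_cons[z_gt1 rs_gt1] _.
rewrite big_cons (lt_le_trans z_gt1) // ler_peMr // big_seq.
by elim/big_ind: _ => [|s t|t /rs_gt1/ltW] //; exact: mulr_ege1.
Qed.

Lemma norm_horner0_int_gt1 (g : {poly int}) : (1 < size g)%N -> `|lead_coef g| = 1 ->
  (forall x : algC, root (map_poly intr g) x -> 1 < `|x|) -> 1 < `|g.[0]|.
Proof.
move=> size_g lead_g root_gt1.
have inj : injective (intr : int -> algC) by exact: intr_inj.
have := @norm_horner0_gt1 _ (map_poly intr g : {poly algC}).
rewrite size_map_inj_poly // lead_coef_map_inj // -intr_norm lead_g.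
move=> /(_ size_g erefl root_gt1).
by rewrite -(rmorph0 (intr : int -> algC)) horner_map /= -intr_norm ltr1z.
Qed.

Lemma irreducible_of_roots_gt1 (f : {poly int}) : f \is monic -> (1 < size f)%N ->
    (forall x : algC, root (map_poly intr f) x -> 1 < `|x|) -> prime `|f.[0]|%N ->
  irreducible_poly (map_poly intr f : {poly rat}).
Proof.
move=> f_monic size_f root_gt1 f0_prime; apply/irreducible_rat_int; split=> // g g1 gf.
have f_neq0 : f != 0 by rewrite monic_neq0.
have g_neq0 : g != 0 by apply: contraNneq f_neq0 => g0; rewrite -dvd0p -g0.
have [r fE] := dvdpP_int gf; set h := zprimitive g in fE.
have factor_gt1 (u v : {poly int}) : f = u * v -> `|lead_coef u| = 1 ->
    (1 < size u)%N -> 1 < `|u.[0]|.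
  move=> fuv lead_u size_u; apply: norm_horner0_int_gt1 => // x ux.
  by apply: root_gt1; rewrite fuv rmorphM rootM ux.
have lead_hr : `|lead_coef h| = 1 /\ `|lead_coef r| = 1.
  have /eqP : `|lead_coef h| * `|lead_coef r| = 1.
    by rewrite -normrM -lead_coefM -fE (monicP f_monic).
  by rewrite -!abszE -PoszM eqz_nat muln_eq1 => /andP[/eqP-> /eqP->].
have h0_gt1 : 1 < `|h.[0]|.
  apply: factor_gt1 fE lead_hr.1 _.
  by rewrite size_zprimitive ltn_neqAle eq_sym g1 size_poly_gt0.
have r_neq0 : r != 0 by apply: contraNneq f_neq0 => r0; rewrite fE r0 mulr0.
have size_r : size r = 1%N.
  apply/eqP; rewrite eqn_leq size_poly_gt0 r_neq0 andbT leqNgt; apply/negP => size_r.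
  have r0_gt1 := factor_gt1 _ _ (etrans fE (mulrC _ _)) lead_hr.2 size_r.
  move: f0_prime; rewrite fE hornerM abszM; move: h0_gt1 r0_gt1.
  rewrite -!abszE !ltz_nat; move: `|h.[0]|%N `|r.[0]|%N => m k m1 k1.
  by case/primeP=> _ /(_ m (dvdn_mulr k (dvdnn m))) /orP[] /eqP; nia.
by rewrite -dvdp_size_eqp // fE size_mul ?zprimitive_eq0 // size_r addn1 size_zprimitive.
Qed.

Lemma exists_root_neq (F : closedFieldType) (f : {poly F}) x : (2 < size f)%N ->
  root f x -> ~~ root f^`() x -> exists2 y, root f y & y != x.
Proof.
move=> size_f /factor_theorem[g fE].
rewrite fE derivM derivXsubC mulr1 rootE hornerD hornerM.
rewrite hornerXsubC subrr mulr0 add0r => gx.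
have /closed_rootP[y gy] : size g != 1%N.
  apply: contraL size_f => /eqP g1.
  by rewrite fE size_Mmonic ?monicXsubC -?size_poly_eq0 ?g1 // size_XsubC.
exists y; first by rewrite rootM gy.
by apply: contraNneq gx => <-.
Qed.

Lemma dvdp_deriv_of_sqr (F : fieldType) (g h : {poly F}) : g ^+ 2 %| h -> g %| h^`().
Proof.
move=> /dvdpP[k ->]; rewrite expr2 !derivM.
apply: dvdp_add; first by rewrite mulrA dvdp_mull.
by apply/dvdp_mull/dvdp_add; [exact: dvdp_mull | exact: dvdp_mulr].
Qed.

Lemma root_of_dvdp_linear (F : fieldType) (g l : {poly F}) c : (1 < size g)%N ->
  size l = 2 -> g %| l -> root l c -> root g c.
Proof.
move=> size_g size_l gl; rewrite (@eqp_root _ g l) // -dvdp_size_eqp // size_l.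
by rewrite eqn_leq size_g -size_l dvdp_leq // -size_poly_gt0 size_l.
Qed.

Lemma irreducible_dvdp_Xn_root (F : fieldType) (g : {poly F}) k : irreducible_poly g ->
  g %| 'X^k -> root g 0.
Proof.
move=> g_irr gXk; have [g_gt1 _] := g_irr.
apply: (@root_of_dvdp_linear _ _ 'X); rewrite ?size_polyX ?rootX //.
apply: contraTT gXk; rewrite -!irreducible_poly_coprime //; exact: coprimep_expr.
Qed.

Lemma exists_mulz_eqmod (n m b : int) : coprimez n m -> exists c, (m %| n * c - b)%Z.
Proof.
case/coprimezP=> [[u v] /= uv]; exists (u * b); apply/dvdzP; exists (- v * b).
have -> : n * (u * b) = u * n * b by ring.
have -> : u * n = 1 - v * m by rewrite -uv; ring.
by ring.
Qed.

(** * The trinomial *)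

Definition disc_factor (a n p : nat) : nat := n ^ n * p + a ^ n * n.-1 ^ n.-1.

Lemma predn_eq0F n : (1 < n)%N -> (n.-1 == 0)%N = false.
Proof. by case: n => [|[]]. Qed.

Section Trinomial.
Variables (a n p : nat).
Hypotheses (a_gt0 : (0 < a)%N) (n_gt1 : (1 < n)%N).

Local Notation f := (f_poly n a p).

Let n_gt0 : (0 < n)%N. Proof. exact: ltnW. Qed.

Let exprnE (R : comNzRingType) (x : R) : x ^+ n = x * x ^+ n.-1.
Proof. by rewrite -exprS prednK. Qed.

Lemma map_f_poly (R : nzRingType) : map_poly intr f
  = 'X^n - a%:R *: 'X^(n.-1) - (p%:R)%:P :> {poly R}.
Proof.
by rewrite !rmorphB /= map_polyZ !map_polyXn map_polyC /= -!pmulrn.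
Qed.

Lemma horner_f_poly (R : comNzRingType) (x : R) :
  (map_poly intr f).[x] = x ^+ n - a%:R * x ^+ n.-1 - p%:R.
Proof. by rewrite map_f_poly !hornerE. Qed.

Lemma horner0_f_poly : f.[0] = - p%:Z.
Proof.
by rewrite /f_poly !hornerE !expr0n (gtn_eqF n_gt0) predn_eq0F // mulr0 !sub0r.
Qed.

Lemma lt_size_f_poly_tail :
  (size (- (a%:Z *: 'X^(n.-1) + (p%:Z)%:P) : {poly int}) < n.+1)%N.
Proof.
rewrite size_polyN (leq_ltn_trans (size_polyD _ _)) // gtn_max.
rewrite (leq_ltn_trans (size_scale_leq _ _)) ?size_polyXn ?prednK //.
by rewrite (leq_ltn_trans (size_polyC_leq1 _)) // ltnW.
Qed.

Let f_polyE : f = 'X^n + (- (a%:Z *: 'X^(n.-1) + (p%:Z)%:P)).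
Proof. by rewrite /f_poly -addrA opprD. Qed.

Lemma size_f_poly : size f = n.+1.
Proof. by rewrite f_polyE size_polyDl size_polyXn // lt_size_f_poly_tail. Qed.

Lemma f_poly_monic : f \is monic.
Proof.
by rewrite monicE f_polyE lead_coefDl ?lead_coefXn // size_polyXn lt_size_f_poly_tail.
Qed.

Lemma root_f_polyE (R : comNzRingType) (x : R) :
  root (map_poly intr f) x = (x ^+ n.-1 * (x - a%:R) == p%:R).
Proof.
by rewrite rootE horner_f_poly subr_eq0 exprnE -mulrBl mulrC.
Qed.

Lemma deriv_f_poly (R : comNzRingType) :
  (map_poly intr f)^`() = 'X^(n.-2) * (n%:R *: 'X - (a%:R * n.-1%:R)%:P) :> {poly R}.
Proof.
rewrite map_f_poly !derivB derivZ !derivXn derivC subr0.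
case: (n) n_gt1 => [|[|m]] // _ /=; rewrite mulrBr -mulr_natl -!mul_polyC.
by rewrite !polyCM -[in RHS]mulr_natl !polyC_natr exprS; ring.
Qed.

Lemma dvdz_disc_factor (c : int) :
  (n%:Z * c - a%:Z * n.-1%:Z %| n%:Z ^+ n * f.[c] + (disc_factor a n p)%:Z)%Z.
Proof.
set x := n%:Z * c; set t := a%:Z * n.-1%:Z.
have -> : n%:Z ^+ n * f.[c] + (disc_factor a n p)%:Z
    = (x ^+ n - t ^+ n) - a%:Z * n%:Z * (x ^+ n.-1 - t ^+ n.-1).
  have -> : f.[c] = c ^+ n - a%:Z * c ^+ n.-1 - p%:Z by rewrite /f_poly !hornerE.
  rewrite /disc_factor -!natz natrD !natrM !natrX !natz !exprnE /x /t !exprMn.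
  have nE : n%:Z = n.-1%:Z + 1 by rewrite -PoszD addn1 prednK.
  by move: nE; set m := n.-1%:Z => nE; rewrite nE; ring.
by rewrite !subrXX; apply: rpredB; [|apply: dvdz_mull]; exact: dvdz_mulr.
Qed.

Section LargePrime.
Hypotheses (p_prime : prime p) (p_gt : (a.+1 < p)%N).

Lemma f_poly_root_gt1 (x : algC) : root (map_poly intr f) x -> 1 < `|x|.
Proof.
rewrite root_f_polyE => /eqP/(congr1 Num.norm); rewrite normrM normrX normr_nat => fx.
rewrite real_ltNge ?normr_real ?real1 //; apply/negP => x_le1.
suff : (p%:R : algC) <= a.+1%:R by rewrite ler_nat leqNgt p_gt.
rewrite -fx; apply: (@le_trans _ _ `|x - a%:R|).
  by rewrite ler_piMl ?normr_ge0 // exprn_ile1 ?normr_ge0.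
by rewrite (le_trans (ler_normB _ _)) // normr_nat -natr1 addrC lerD2l.
Qed.

Lemma f_poly_irreducible : irreducible_poly (map_poly intr f : {poly rat}).
Proof.
apply: irreducible_of_roots_gt1 f_poly_monic _ f_poly_root_gt1 _.
  by rewrite size_f_poly.
by rewrite horner0_f_poly abszN.
Qed.

Lemma f_poly_real_root : exists2 la : algC, root (map_poly intr f) la & a%:R < la.
Proof.
have f1_le0 : (map_poly intr f).[1] <= 0 :> algR.
  rewrite horner_f_poly !expr1n mulr1 subr_le0.
  by rewrite (@le_trans _ _ 0) // subr_le0 ler1n.
have f_ge0 : 0 <= (map_poly intr f).[(a + p)%:R] :> algR.
  rewrite horner_f_poly exprnE -mulrBl natrD addrAC subrr add0r subr_ge0.
  by rewrite ler_peMr // exprn_ege1 // -natrD ler1n addn_gt0 a_gt0.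
have le_ap : 1 <= (a + p)%:R :> algR by rewrite ler1n addn_gt0 a_gt0.
have [x /andP[x_ge1 _] fx] := poly_ivt le_ap (introT andP (conj f1_le0 f_ge0)).
have f_la : root (map_poly intr f) (val x : algC).
  have -> : map_poly intr f = map_poly algRval (map_poly intr f) :> {poly algC}.
    by rewrite -map_poly_comp; apply: eq_map_poly => z; rewrite /= rmorph_int.
  exact: rmorph_root.
exists (val x) => //; have la_ge1 : 1 <= val x :> algC by exact: x_ge1.
have : 0 < p%:R :> algC by rewrite ltr0n prime_gt0.
move: f_la; rewrite root_f_polyE => /eqP <-; rewrite pmulr_rgt0 ?subr_gt0 //.
by rewrite exprn_gt0 // (lt_le_trans ltr01).
Qed.

(* On |x| >= la one has |x|^(n-1) |x - a| >= la^(n-1) (la - a) = p, with equality only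
   at la. *)
Lemma f_poly_root_norm_lt (la x : algC) : root (map_poly intr f) la -> a%:R < la ->
  root (map_poly intr f) x -> x <> la -> `|x| < la.
Proof.
rewrite !root_f_polyE => /eqP f_la la_gt /eqP/(congr1 Num.norm).
rewrite normrM normrX normr_nat -f_la => fx x_neq.
have la_gt0 : 0 < la by rewrite (le_lt_trans _ la_gt).
have dist_ge : `|x| - a%:R <= `|x - a%:R|.
  by have := lerB_dist x a%:R; rewrite normr_nat.
rewrite real_ltNge ?normr_real ?gtr0_real //; apply/negP => le_x.
have dist_eq : `|x - a%:R| = la - a%:R.
  apply/le_anti; rewrite (le_trans _ dist_ge) ?lerD2r // andbT.
  rewrite -(ler_pM2l (exprn_gt0 n.-1 la_gt0)) -fx ler_wpM2r //.
  by rewrite lerXn2r ?nnegrE // ltW.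
have norm_eq : `|x| = la.
  by apply/le_anti; rewrite le_x andbT; move: dist_ge; rewrite dist_eq lerD2r.
have := @normCDeq _ (x - a%:R) a%:R.
rewrite subrK dist_eq normr_nat norm_eq subrK => /(_ erefl)[t _ [xE aE]].
have t1 : t = 1.
  have a_neq0 : a%:R != 0 :> algC by rewrite pnatr_eq0 -lt0n.
  by apply: (mulfI a_neq0); rewrite mulr1 -aE.
by apply: x_neq; move: xE; rewrite t1 mulr1 => /addIr.
Qed.

Lemma f_poly_exists_root_neq (la : algC) : root (map_poly intr f) la -> a%:R < la ->
  exists2 x, root (map_poly intr f) x & x != la.
Proof.
move=> f_la la_gt; have la_gt0 : 0 < la by rewrite (le_lt_trans _ la_gt).
apply: (exists_root_neq _ f_la).
  by rewrite size_map_inj_poly ?size_f_poly //; exact: intr_inj.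
rewrite deriv_f_poly rootE !hornerE mulf_neq0 ?expf_neq0 ?gt_eqF //.
rewrite subr_gt0 (@le_lt_trans _ _ (n%:R * a%:R)) ?ltr_pM2l ?ltr0n //.
by rewrite -!natrM ler_nat mulnC leq_mul2r leq_pred orbT.
Qed.

Lemma f_poly_strictly_perron : strictly_perron_poly f.
Proof.
have [la f_la la_gt] := f_poly_real_root.
have la_gt0 : 0 < la by rewrite (le_lt_trans _ la_gt).
have la_gt1 : 1 < la by have := f_poly_root_gt1 f_la; rewrite gtr0_norm.
have minE : minCpoly la = map_poly intr f.
  exact: minCpoly_monic_irreducible f_poly_monic f_poly_irreducible f_la.
have conjE x : conjugate la x = root (map_poly intr f) x by rewrite /conjugate minE.
have conj_gt1 x : conjugate la x -> 1 < `|x|.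
  by rewrite conjE; exact: f_poly_root_gt1.
exists la; split; first by rewrite /is_min_poly minE.
- split=> [|x]; last by rewrite conjE; exact: f_poly_root_norm_lt.
  by split; [exact: gtr0_real | exact: Aint_root f_poly_monic f_la |].
- move=> [_ conj_lt1].
  have [x f_x /eqP x_neq] := f_poly_exists_root_neq f_la la_gt.
  have conj_x : conjugate la x by rewrite conjE.
  by have := lt_trans (conj_gt1 x conj_x) (conj_lt1 x conj_x x_neq); rewrite ltxx.
- move=> [_ [x [[/conj_gt1 x_gt1 x_lt1] _]] _].
  by have := lt_trans x_gt1 x_lt1; rewrite ltxx.
- move=> [_ _ /conj_gt1 + _]; rewrite normfV gtr0_norm // invf_gt1 //.
  by move=> /(lt_trans la_gt1); rewrite ltxx.
Qed.

Section Monogenic.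
Hypotheses (coprime_an : coprime a n) (disc_squarefree : squarefree (disc_factor a n p)).

Section ModPrime.
Variable q : nat.
Hypothesis q_prime : prime q.

Let natr_Fq_eq0 m : (m%:R == 0 :> 'F_q) = (q %| m)%N.
Proof. by rewrite (dvdn_pcharf (pchar_Fp q_prime)). Qed.

Definition linear_factor : {poly 'F_q} := n%:R *: 'X - (a%:R * n.-1%:R)%:P.

Lemma ndvd_n_of_dvdp_linear_factor (g : {poly 'F_q}) : (1 < size g)%N ->
  g %| linear_factor -> ~~ (q %| n)%N.
Proof.
move=> g_gt1 gL; apply/negP => qn; move: gL.
have q_an : coprime q (a * n.-1).
  rewrite (coprime_dvdl qn) // coprimeMr ![coprime n _]coprime_sym.
  by rewrite coprime_an coprimePn.
rewrite /linear_factor (eqP (_ : n%:R == 0)) ?natr_Fq_eq0 // scale0r sub0r dvdpNr.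
move=> /dvdp_leq; rewrite polyC_eq0 -natrM natr_Fq_eq0 -prime_coprime //.
by move=> /(_ q_an); rewrite leqNgt (leq_ltn_trans (size_polyC_leq1 _)).
Qed.

Lemma size_linear_factor : ~~ (q %| n)%N -> size linear_factor = 2.
Proof.
move=> qn; rewrite /linear_factor size_polyDl ?size_scale ?size_polyX ?natr_Fq_eq0 //.
by rewrite size_polyN ltnS size_polyC_leq1.
Qed.

Lemma prime_sqr_ndvd_f_poly0 : ~~ (q%:Z ^+ 2 %| f.[0])%Z.
Proof.
rewrite horner0_f_poly dvdzE abszN abszX /=; apply/negP => q2p.
have := dvdn_leq (prime_gt0 p_prime) q2p.
have <- : q = p by apply/eqP; rewrite -dvdn_prime2 // (dvdn_trans _ q2p) ?dvdn_mulr.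
by rewrite leqNgt -{1}(expn1 q) ltn_exp2l ?prime_gt1.
Qed.

(* A multiple irreducible factor g of f modulo q divides f'; so g is associate to X, or
   to n X - a (n - 1) with n invertible modulo q. *)
Lemma f_poly_multiple_factor_root (g : {poly 'F_q}) :
    irreducible_poly g -> g ^+ 2 %| polymod q f ->
  exists2 c : int, root g c%:~R & ~~ (q%:Z ^+ 2 %| f.[c])%Z.
Proof.
move=> g_irr g2f; have [g_gt1 _] := g_irr.
have := dvdp_deriv_of_sqr g2f; rewrite [polymod q f]/(map_poly intr f) deriv_f_poly.
rewrite -/linear_factor; case: (boolP (g %| linear_factor)) => [gL _|gL]; last first.
  rewrite Gauss_dvdpl ?irreducible_poly_coprime //.
  move=> /(irreducible_dvdp_Xn_root g_irr) g0.
  by exists 0 => //; exact: prime_sqr_ndvd_f_poly0.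
have qn := ndvd_n_of_dvdp_linear_factor g_gt1 gL.
have [c cE] : exists c, (q%:Z ^+ 2 %| n%:Z * c - a%:Z * n.-1%:Z)%Z.
  apply: exists_mulz_eqmod; rewrite coprimezE abszX /= coprimeXr //.
  by rewrite coprime_sym prime_coprime.
exists c.
  apply: (root_of_dvdp_linear g_gt1 (size_linear_factor qn) gL).
  rewrite rootE !hornerE -natrM !pmulrn -intrM -rmorphB /= intr_Fp_eq0 // PoszM.
  by apply: dvdz_trans cE; rewrite expr2 dvdz_mulr.
apply/negP => q2fc; have /negP[] := disc_squarefree q_prime.
have := dvdz_trans cE (dvdz_disc_factor c).
by rewrite rpredDl ?dvdz_mull // dvdzE abszX.
Qed.
End ModPrime.

Lemma f_poly_monogenic : monogenic f.
Proof.
apply: monogenic_criterion f_poly_monic f_poly_irreducible _.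
exact: f_poly_multiple_factor_root.
Qed.
End Monogenic.
End LargePrime.
End Trinomial.

Lemma coprime_disc_factor_coeffs a n : (0 < n)%N -> coprime a n ->
  coprime (n ^ n) (a ^ n * n.-1 ^ n.-1).
Proof.
by move=> n0 an; rewrite coprimeXl // coprimeMr !coprimeXr // coprime_sym ?coprimePn.
Qed.

Lemma odd_disc_factor a n p : (1 < n)%N -> coprime a n -> odd p ->
  odd (disc_factor a n p).
Proof.
move=> n1 an odd_p; have n0 := ltnW n1.
have odd_pred : odd n.-1 = ~~ odd n by rewrite -[in RHS](prednK n0) oddS negbK.
rewrite oddD !oddM !oddX odd_p (gtn_eqF n0) predn_eq0F // odd_pred.
case: (boolP (odd n)) => [_|even_n]; first by rewrite andbF.
by rewrite /= andbT -(coprimen2 a) (coprime_dvdr _ an) // dvdn2.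
Qed.

Theorem theorem1p1 (a : int) (n : nat) (ha : 1 <= a) (hn : (2 <= n)%N)
    (hgcd : gcdz a n%:Z = 1) :
  forall N : nat, exists p : nat,
    [/\ (N < p)%N, prime p, monogenic (f_poly n a p)
      & strictly_perron_poly (f_poly n a p)].
Proof.
case: a ha hgcd => // a a_gt0 [/eqP coprime_an] N.
have [p [p_gt p_prime disc_sqf]] := infinitely_many_primes_squarefree (maxn N a.+1)
  (coprime_disc_factor_coeffs (ltnW hn) coprime_an)
  (fun p => odd_disc_factor hn coprime_an).
move: p_gt; rewrite gtn_max => /andP[Np ap]; exists p; split=> //.
  exact: f_poly_monogenic.
exact: f_poly_strictly_perron.
Qed.
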